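(* Neither does weak adjointability of $\varkappa$ imply regularity of the $\varkappa$-interacting Fock space, nor does regularity imply weak adjointability of $\varkappa$. That is: there exists a $\varkappa$-interacting Fock space $(H,\varkappa)$ such that $\varkappa$ is weakly adjointable but $(H,\varkappa)$ is not regular (as an interacting Fock space based on $H$); and there exists a $\varkappa$-interacting Fock space $(H,\varkappa)$ that is regular (as an interacting Fock space based on $H$) but such that $\varkappa$ is not weakly adjointable.
   Context: All vector spaces are complex; direct sums and tensor products of pre-Hilbert spaces are algebraic; $\overline V$ is the completion of a pre-Hilbert space $V$. A linear map $b\colon V\to W\subset\overline W$ between pre-Hilbert spaces is weakly adjointable if there is a linear map $b^*\colon W\to\overline V$ with $\langle bv,w\rangle=\langle v,b^*w\rangle$ for all $v\in V,w\in W$. $H$ is a pre-Hilbert space; $\mathscr F(H)=\Omega\mathbb C\oplus\bigoplus_{n\ge1}H^{\otimes n}$ is the algebraic full Fock space with natural inner product, $\Omega$ a unit vector; $\ell^*(x)\colon X\mapsto x\otimes X$ (with $x\otimes\Omega=x$). A pre-Fock subspace of $\overline{\mathscr F(H)}$ is an algebraic direct sum $\mathcal I=\bigoplus_{n\in\mathbb N_0}H_n$ of subspaces $H_n\subset\overline{H^{\otimes n}}$ with $H_0=\Omega\mathbb C$; $\mathcal D_{\mathcal I}:=\mathcal I\oplus\mathcal I^\perp\subset\overline{\mathscr F(H)}$. A squeezing relative to $\mathcal I$ is a linear map $\varkappa\colon(H\otimes\mathcal D_{\mathcal I})\oplus\Omega\mathbb C\to\mathcal D_{\mathcal I}$ with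 $\varkappa\Omega=\Omega$, preserving degree (elements of $\overline{H^{\otimes n}}$ go to $\overline{H^{\otimes n}}$), with range $\mathcal I$ and vanishing on $H\otimes\mathcal I^\perp$. The $\varkappa$-interacting Fock space $(H,\varkappa)$ is $\mathcal I$ with creators $a^*(x)\colon\mathcal I\to\mathcal I$ ($x\in H$), the (co)restrictions of $\varkappa\ell^*(x)$. It is regular (as an interacting Fock space based on $H$) if the linear map $\Lambda\colon\mathscr F(H)\to\mathcal I$, $\Lambda\Omega=\Omega$, $\Lambda(x_n\otimes\dots\otimes x_1)=a^*(x_n)\cdots a^*(x_1)\Omega$, is weakly adjointable (with weak adjoint $\mathcal I\to\overline{\mathscr F(H)}$). *)

(* Defs.v *)
From HB Require Import structures.
From mathcomp Require Import all_boot all_order all_algebra.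
From mathcomp Require Import sesquilinear.
From mathcomp Require Import complex.
From mathcomp Require Import classical_sets reals.

Set Implicit Arguments.
Unset Strict Implicit.
Unset Printing Implicit Defensive.

Import Order.TTheory GRing.Theory Num.Theory.
Local Open Scope ring_scope.
Local Open Scope classical_set_scope.

(* Forms of type {dot V for Num.conj} are linear in the first and conjugate-linear
   in the second argument.  No notion below depends on this convention. *)
Record preHilbert (R : realType) := PreHilbert {
  ph_space :> lmodType R[i];
  dotp : {dot ph_space for Num.conj}
}.

Notation "''[' u , v ]" := (dotp _ u v) : ring_scope.

Section InnerProductSpaces.
Variable R : realType.
Local Notation C := R[i].

(* In the order of R[i], [0 < e] says that e is real and positive, so the
   bounds below are bounds on squared norms by positive reals. *)
Definition complete_space (V : preHilbert R) : Prop :=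
  forall u : nat -> V,
    (forall e : C, 0 < e -> exists N : nat, forall m n : nat,
       (N <= m)%N -> (N <= n)%N -> '[u m - u n, u m - u n] < e) ->
    exists l : V, forall e : C, 0 < e -> exists N : nat, forall n : nat,
       (N <= n)%N -> '[u n - l, u n - l] < e.

Record hilbert := Hilbert {
  hilbert_space :> preHilbert R;
  hilbert_complete : complete_space hilbert_space
}.

Section Subsets.
Variable V : preHilbert R.
Implicit Types (A D W : set V) (b : V -> V).

Definition lin_subspace A : Prop :=
  A 0 /\ forall (a : C) u v, A u -> A v -> A (a *: u + v).

Definition norm_closure A : set V :=
  [set z | forall e : C, 0 < e -> exists2 a, A a & '[z - a, z - a] < e].

Definition orth A : set V := [set z | forall a, A a -> '[z, a] = 0].

Definition line (w : V) : set V := [set z | exists a : C, z = a *: w].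

Definition add_sets A B : set V :=
  [set z | exists2 a, A a & exists2 b, B b & z = a + b].

(* The algebraic sum of a sequence of subspaces: finite sums only. *)
Definition graded_sum (A : nat -> set V) : set V :=
  [set z | exists (N : nat) (x : nat -> V),
     (forall n, A n (x n)) /\ z = \sum_(n < N) x n].

(* A linear map defined on a subspace D is represented by a function on the
   whole space, of which only the values on D are ever used. *)
Definition linear_on D b : Prop :=
  forall (a : C) u v, D u -> D v -> b (a *: u + v) = a *: b u + b v.

End Subsets.

(* b : D -> W for subspaces D, W of a Hilbert space K; the completion of D is
   its closure in K. *)
Definition weakly_adjointable (K : hilbert) (D W : set K) (b : K -> K) : Prop :=
  exists b' : K -> K,
    [/\ linear_on W b',
        forall w, W w -> norm_closure D (b' w)
      & forall v w, D v -> W w -> '[b v, w] = '[v, b' w] ].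

(* T, with u (x) v := t u v, is the algebraic tensor product of the vector
   spaces U and V, endowed with the inner product of a tensor product. *)
Record is_tensor_product (U V T : preHilbert R)
    (t : {bilinear U -> V -> T}) : Prop := {
  tensor_universal : forall (W : lmodType C) (f : {bilinear U -> V -> W}),
    exists g : {linear T -> W},
      (forall u v, g (t u v) = f u v) /\
      (forall g' : {linear T -> W}, (forall u v, g' (t u v) = f u v) -> g' =1 g);
  tensor_dotp : forall u u' v v', '[t u v, t u' v'] = '[u, u'] * '[v, v']
}.

End InnerProductSpaces.

(* The full Fock space of H, which is determined by H up to a unitary:
   the n-fold algebraic tensor powers [tpow n], with tpow 0 = C Omega and
   tpow n.+1 = H (x) tpow n, and the completion [fbar] of their algebraic
   orthogonal direct sum. *)
Record fullFock (R : realType) (H : preHilbert R) := FullFock {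
  tpow : nat -> preHilbert R;
  vac0 : tpow 0;
  vac0_unit : '[vac0, vac0] = 1;
  vac0_span : forall X : tpow 0, exists a : R[i], X = a *: vac0;
  tens : forall n, {bilinear H -> tpow n -> tpow n.+1};
  tensP : forall n, is_tensor_product (tens n);
  fbar : hilbert R;
  emb : forall n, {linear tpow n -> fbar};
  emb_isometric : forall n (X Y : tpow n), '[emb n X, emb n Y] = '[X, Y];
  emb_orthogonal : forall m n (X : tpow m) (Y : tpow n),
    m <> n -> '[emb m X, emb n Y] = 0;
  emb_dense : forall z, norm_closure (graded_sum (fun n => range (emb n))) z;
  (* x |-> l^*(x), extended by continuity to the completed Fock space *)
  lcre : H -> {linear fbar -> fbar};
  lcre_emb : forall x n (X : tpow n), lcre x (emb n X) = emb n.+1 (tens n x X);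
  lcre_bounded : forall x, exists M : R[i],
    forall z, '[lcre x z, lcre x z] <= M * '[z, z]
}.

Section InteractingFockSpaces.
Variables (R : realType) (H : preHilbert R) (F : fullFock H).
Local Notation Fb := (fbar F).

Definition vac : Fb := emb F 0 (vac0 F).

Definition algFock : set Fb := graded_sum (fun n => range (emb F n)).

(* The closure of H^{(x) n} in the completed Fock space is its completion. *)
Definition degree (n : nat) : set Fb := norm_closure (range (emb F n)).

(* H (x) D for a subspace D of the completed Fock space, as the subspace of the
   completed Fock space spanned by the x (x) d = l^*(x) d; the canonical map
   from the algebraic tensor product is isometric, hence injective. *)
Definition tensor_set (D : set Fb) : set Fb :=
  [set z | exists (N : nat) (x : nat -> H) (d : nat -> Fb),
     (forall i, D (d i)) /\ z = \sum_(i < N) lcre F (x i) (d i)].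

(* The sum of the Hn is direct, as the degrees are mutually orthogonal. *)
Record preFock := PreFock {
  pf_comp : nat -> set Fb;
  pf_subspace : forall n, lin_subspace (pf_comp n);
  pf_degree : forall n, pf_comp n `<=` degree n;
  pf_vac : pf_comp 0 = line vac
}.

Definition pf_space (I : preFock) : set Fb := graded_sum (pf_comp I).

Definition pf_D (I : preFock) : set Fb :=
  add_sets (pf_space I) (orth (pf_space I)).

Definition squeeze_dom (I : preFock) : set Fb :=
  add_sets (tensor_set (pf_D I)) (line vac).

Record is_squeezing (I : preFock) (k : Fb -> Fb) : Prop := {
  sq_linear : linear_on (squeeze_dom I) k;
  sq_vac : k vac = vac;
  sq_degree : forall n z, squeeze_dom I z -> degree n z -> degree n (k z);
  sq_range : k @` squeeze_dom I = pf_space I;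
  sq_vanish : forall z, tensor_set (orth (pf_space I)) z -> k z = 0
}.

Definition squeezing_weakly_adjointable (I : preFock) (k : Fb -> Fb) : Prop :=
  weakly_adjointable (squeeze_dom I) (pf_D I) k.

(* The creator a^*(x); only its values on the pre-Fock subspace are used. *)
Definition creator (k : Fb -> Fb) (x : H) (z : Fb) : Fb := k (lcre F x z).

(* L restricts to the linear map Lambda on the algebraic Fock space; the list
   [:: x_n; ...; x_1] encodes the elementary tensor x_n (x) ... (x) x_1. *)
Definition is_Lambda (k : Fb -> Fb) (L : Fb -> Fb) : Prop :=
  [/\ linear_on algFock L,
      L vac = vac
    & forall xs : seq H,
        L (foldr (fun x z => lcre F x z) vac xs) = foldr (creator k) vac xs].

Definition regular (I : preFock) (k : Fb -> Fb) : Prop :=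
  exists2 L : Fb -> Fb,
    is_Lambda k L & weakly_adjointable algFock (pf_space I) L.

End InteractingFockSpaces.

Record interactingFock (R : realType) := InteractingFock {
  if_base : preHilbert R;
  if_fock : fullFock if_base;
  if_prefock : preFock if_fock;
  if_squeeze : fbar if_fock -> fbar if_fock;
  if_squeezeP : is_squeezing if_prefock if_squeeze
}.

Arguments if_squeeze {R} _ _.

(* Main.v *)
Require Import Defs.
From HB Require Import structures.
From mathcomp Require Import all_boot all_order all_algebra.
From mathcomp Require Import sesquilinear complex.
From mathcomp Require Import boolp classical_sets functions fsbigop reals.
From mathcomp Require Import ring lra.

(** Let H be the span of an orthonormal sequence e_0, e_1, e_2, ..., and write
    e_w for the elementary tensor of basis vectors spelled by a word w of
    natural numbers; these form an orthonormal basis of the completed Fock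
    space.  Two sequences a and b of complex numbers, with all a_n and b_0
    nonzero, give an interacting Fock space that lives in degrees 0, 1 and 2:
    the pre-Fock subspace has components C Omega, H and C e_00, and the
    squeezing is
<<
        Omega |-> Omega,   e_n |-> a_n e_n,   e_0n |-> b_n e_00,
>>
    all other basis words being sent to 0.  Since the creators are applied to
    what earlier creators have produced, the map Lambda is of the same shape,
    with b_n replaced by a_n b_n:
<<
        Omega |-> Omega,   e_n |-> a_n e_n,   e_0n |-> a_n b_n e_00
>>
    (lemma [Lambda_recursion]).  In degrees 0 and 1 such a map is a diagonal
    operator, and since the vectors it has to be tested against are there finite
    combinations of the e_n, it has a weak adjoint whatever a is.  In degree 2
    it is a linear functional times e_00, so that it has a weak adjoint if and
    only if the functional is bounded, that is, if and only if its sequence of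
    weights is square summable (lemmas [weighted_adjointable] and
    [weighted_adjointable_sqsum]).  Hence
<<
        the squeezing is weakly adjointable  iff  b is square summable,
        the space is regular                 iff  a b is square summable
>>
    ([squeezing_adjointable_iff], [regular_iff]), and neither condition implies
    the other: take a_n = 2^n, b_n = 2^-n on the one hand and a_n = 2^-n,
    b_n = 1 on the other.

    The Fock space itself is realized as the Hilbert space of square-summable
    families indexed by words.  Its n-th algebraic tensor power consists of the
    finitely supported families on words of length n; creation by a letter
    prepends that letter, and the universal property of the tensor products is
    linear extension from basis words. *)

Set Implicit Arguments.
Unset Strict Implicit.
Unset Printing Implicit Defensive.

Import Order.TTheory GRing.Theory Num.Theory.
Local Open Scope ring_scope.
Local Open Scope classical_set_scope.

(** * Unconditional summation *)

Section FiniteSums.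
Variables (I : eqType) (V : nmodType).
Implicit Types (s : seq I) (g : I -> V).

Lemma sum_extend s0 s g : uniq s0 -> uniq s -> {subset s0 <= s} ->
  \sum_(i <- s) g i = \sum_(i <- s0) g i + \sum_(i <- s | i \notin s0) g i.
Proof.
move=> u0 u h; rewrite (bigID (mem s0)) /= -(big_filter _ (mem s0)).
congr (_ + _); apply: perm_big; apply: uniq_perm => // [|i].
  exact: filter_uniq.
by rewrite mem_filter /=; case: (boolP (i \in s0)) => // si; rewrite h.
Qed.

(** Two finite sets that contain the support give the same sum, because both
    agree with the sum over their union. *)
Lemma sum_support s0 s g : uniq s0 -> uniq s ->
  (forall i, g i <> 0 -> i \in s0) -> (forall i, g i <> 0 -> i \in s) ->
  \sum_(i <- s) g i = \sum_(i <- s0) g i.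
Proof.
move=> u0 u h0 h.
have ext s1 : uniq s1 -> {subset s1 <= s0 ++ s} ->
    (forall i, g i <> 0 -> i \in s1) ->
    \sum_(i <- undup (s0 ++ s)) g i = \sum_(i <- s1) g i.
  move=> u1 h1 s1g; rewrite (@sum_extend s1) ?undup_uniq //; last first.
    by move=> i /h1; rewrite mem_undup.
  rewrite [X in _ + X]big1 ?addr0 // => i ni.
  by apply: contrapT => /s1g; rewrite (negPf ni).
by rewrite -(ext s0) // -?(ext s) // => i; rewrite mem_cat => ->; rewrite ?orbT.
Qed.

End FiniteSums.

Section Sums.
Variables (R : realType) (I : choiceType).
Local Notation C := R[i].
Implicit Types (s : seq I) (g h : I -> C).

(** Convergence of the net of finite partial sums, which makes sense for
    any index set. *)
Definition sums_to g (l : C) : Prop := forall e : C, 0 < e ->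
  exists s0, forall s, uniq s -> {subset s0 <= s} ->
    `|\sum_(i <- s) g i - l| < e.

Lemma small_eq0 (z : C) : (forall e : C, 0 < e -> `|z| < e) -> z = 0.
Proof.
move=> h; apply/eqP; rewrite -normr_eq0; apply/negPn/negP => nz.
have := h `|z|; rewrite ltxx => /(_ _)/negP; apply=> //.
by rewrite lt_def nz normr_ge0.
Qed.

Lemma sums_to_unique g l l' : sums_to g l -> sums_to g l' -> l = l'.
Proof.
move=> gl gl'; apply/eqP; rewrite -subr_eq0.
apply/eqP; apply: small_eq0 => e e0.
have e2 : 0 < e / 2 by rewrite divr_gt0 ?ltr0n.
have [s0 h0] := gl _ e2; have [s1 h1] := gl' _ e2.
have u := undup_uniq (s0 ++ s1).
have {}h0 := h0 _ u; have {}h1 := h1 _ u.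
set S := \sum_(i <- _) _ in h0 h1.
have -> : l - l' = (S - l') - (S - l) by ring.
rewrite (le_lt_trans (ler_normB _ _)) // [e]splitr ltrD //.
  by apply: h1 => i; rewrite mem_undup mem_cat => ->; rewrite orbT.
by apply: h0 => i; rewrite mem_undup mem_cat => ->.
Qed.

Lemma sums_to_lin a g h l m : sums_to g l -> sums_to h m ->
  sums_to (fun i => a * g i + h i) (a * l + m).
Proof.
move=> gl hm e e0.
have e2 : 0 < e / 2 by rewrite divr_gt0 ?ltr0n.
have a1 : 0 < `|a| + 1 by rewrite ltr_wpDl.
have [s0 h0] := gl _ (divr_gt0 e2 a1); have [s1 h1] := hm _ e2.
exists (s0 ++ s1) => s u sub.
rewrite big_split /= -mulr_sumr.
have {}h0 := h0 _ u; have {}h1 := h1 _ u.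
set S := \sum_(i <- s) g i in h0 *; set T := \sum_(i <- s) h i in h1 *.
have -> : a * S + T - (a * l + m) = a * (S - l) + (T - m) by ring.
rewrite (le_lt_trans (ler_normD _ _)) // [ltRHS]splitr ltrD //; last first.
  by apply: h1 => i si; apply: sub; rewrite mem_cat si orbT.
have {}h0 : `|S - l| < e / 2 / (`|a| + 1).
  by apply: h0 => i si; apply: sub; rewrite mem_cat si.
rewrite normrM (@le_lt_trans _ _ (`|S - l| * (`|a| + 1))) //.
  by rewrite mulrC ler_wpM2l // lerDl.
by rewrite -ltr_pdivlMr.
Qed.

Lemma sums_to_conj g l : sums_to g l -> sums_to (fun i => (g i)^*) (l^*).
Proof.
move=> gl e e0; have [s0 h] := gl e e0; exists s0 => s u sub.
by rewrite -rmorph_sum -rmorphB norm_conjC; apply: h.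
Qed.

Lemma sums_to_finite g s : uniq s -> (forall i, g i <> 0 -> i \in s) ->
  sums_to g (\sum_(i <- s) g i).
Proof.
move=> u gs e e0; exists s => t ut st.
by rewrite (@sum_support _ _ s t) ?subrr ?normr0 // => i /gs /st.
Qed.

(** A bounded set of nonnegative complex numbers consists of reals, hence has a
    supremum; this imports the completeness of the reals in the order of the
    complex numbers. *)
Lemma complex_sup (A : set C) : A !=set0 -> (forall x, A x -> 0 <= x) ->
  (exists M, forall x, A x -> x <= M) ->
  exists l, [/\ forall x, A x -> x <= l,
    forall M, (forall x, A x -> x <= M) -> l <= M
    & forall e : C, 0 < e -> exists2 x, A x & l - e < x].
Proof.
move=> [x0 Ax0] A0 bdA.
have ReK (x : C) : 0 <= x -> (complex.Re x)%:C%C = x.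
  by move=> x_ge0; rewrite RRe_real ?ger0_real.
have mono (x y : C) : x <= y -> complex.Re x <= complex.Re y.
  by rewrite lecE => /andP[].
set B := [set complex.Re x | x in A].
have B0 : B !=set0 by exists (complex.Re x0), x0.
have supB : has_sup B.
  split=> //; have [M AM] := bdA; exists (complex.Re M) => _ [x Ax <-].
  exact/mono/AM.
exists (sup B)%:C%C; split=> [x Ax|M AM|e e0].
- rewrite -(ReK x) ?A0 // lecR; apply: ub_le_sup; first by case: supB.
  by exists x.
- rewrite -(ReK M) ?(le_trans _ (AM _ Ax0)) ?A0 // lecR.
  by apply: ge_sup => // _ [x Ax <-]; apply/mono/AM.
have eR : (complex.Re e)%:C%C = e by rewrite ReK ?ltW.
have [_ [x Ax <-] h] : exists2 r, B r & sup B - complex.Re e < r.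
  by apply: sup_adherent; rewrite // -ltcR eR.
by exists x => //; rewrite -eR -(ReK x) ?A0 // -rmorphB ltcR.
Qed.

Definition bounded_sums g (M : C) : Prop :=
  forall s, uniq s -> \sum_(i <- s) g i <= M.

(** Monotone convergence: the sum is the supremum of the finite partial sums. *)
Lemma bounded_sums_cvg g M : (forall i, 0 <= g i) -> bounded_sums g M ->
  exists l, [/\ sums_to g l, bounded_sums g l & l <= M].
Proof.
move=> g0 gM.
have [|||l [ub least ad]] := @complex_sup
    [set x | exists2 s, uniq s & x = \sum_(i <- s) g i].
- by exists 0, [::] => //; rewrite big_nil.
- by move=> _ [s us ->]; apply: sumr_ge0 => i _; apply: g0.
- by exists M => _ [s us ->]; apply: gM.
have gl : bounded_sums g l by move=> s us; apply: ub; exists s.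
exists l; split=> // [e e0|]; last by apply: least => _ [s us ->]; apply: gM.
have [_ [s0 u0 ->] h0] := ad _ e0; exists s0 => s us sub.
have := gl s us; rewrite -subr_ge0 => hs.
rewrite -(opprB l) normrN ger0_norm // ltrBlDr -ltrBlDl (lt_le_trans h0) //.
by rewrite (sum_extend _ u0 us sub) lerDl sumr_ge0.
Qed.

Lemma sums_to_bounded g l M : (forall i, 0 <= g i) -> bounded_sums g M ->
  sums_to g l -> bounded_sums g l /\ l <= M.
Proof.
move=> g0 gM gl; have [l' [gl' bl' lM]] := bounded_sums_cvg g0 gM.
by rewrite (sums_to_unique gl gl').
Qed.

End Sums.

(** * The Hilbert space of square-summable families *)

Section SquareSummable.
Variables (R : realType) (I : choiceType).
Local Notation C := R[i].
Implicit Types (s : seq I) (f g : I -> C).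

Definition sqsum f : Prop := exists M, bounded_sums (fun i => `|f i| ^+ 2) M.

Definition l2_pred : pred (I -> C) := fun f => `[< sqsum f >].

Lemma sqr_norm_ge0 f i : 0 <= `|f i| ^+ 2.
Proof. by rewrite exprn_ge0. Qed.

(** The parallelogram identity with one square dropped. *)
Lemma sqr_normD_le (x y : C) : `|x + y| ^+ 2 <= 2 * (`|x| ^+ 2 + `|y| ^+ 2).
Proof.
have -> : 2 * (`|x| ^+ 2 + `|y| ^+ 2) = `|x + y| ^+ 2 + `|x - y| ^+ 2.
  by rewrite !normCK !rmorphD !rmorphN; ring.
by rewrite lerDl exprn_ge0.
Qed.

Lemma sqsum_lin a f g : sqsum f -> sqsum g -> sqsum (a *: f + g).
Proof.
move=> [M fM] [N gN]; exists (2 * (`|a| ^+ 2 * M + N)) => s us.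
rewrite (@le_trans _ _
  (\sum_(i <- s) 2 * (`|a| ^+ 2 * `|f i| ^+ 2 + `|g i| ^+ 2))) //.
  apply: ler_sum => i _; apply: le_trans (sqr_normD_le _ _) _.
  by rewrite normrM exprMn.
rewrite -mulr_sumr ler_wpM2l // big_split /= -mulr_sumr lerD ?gN //.
by rewrite ler_wpM2l ?exprn_ge0 ?fM.
Qed.

Lemma sqsum_finite f s : (forall i, f i <> 0 -> i \in s) -> sqsum f.
Proof.
move=> fs; exists (\sum_(i <- undup s) `|f i| ^+ 2) => t ut.
rewrite -(@sum_support _ _ (undup s) (undup (t ++ s))) ?undup_uniq //.
- rewrite (@sum_extend _ _ t) ?undup_uniq // => [|i ti].
    by rewrite lerDl sumr_ge0 // => i _; rewrite exprn_ge0.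
  by rewrite mem_undup mem_cat ti.
- move=> i fi; rewrite mem_undup fs // => f0; apply: fi.
  by rewrite f0 normr0 expr0n.
- move=> i fi; rewrite mem_undup mem_cat fs ?orbT // => f0; apply: fi.
  by rewrite f0 normr0 expr0n.
Qed.

Lemma l2_submod : submod_closed l2_pred.
Proof.
split=> [|a f g /asboolP hf /asboolP hg]; apply/asboolP.
  exact: (@sqsum_finite _ [::]).
exact: sqsum_lin.
Qed.

HB.instance Definition _ :=
  GRing.isSubmodClosed.Build C (I -> C) l2_pred l2_submod.

Definition l2 := {f : I -> C | l2_pred f}.
HB.instance Definition _ := SubType.on l2.
HB.instance Definition _ := [Choice of l2 by <:].
HB.instance Definition _ := [SubChoice_isSubZmodule of l2 by <:].
HB.instance Definition _ := [SubZmodule_isSubLmodule of l2 by <:].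

Definition l2fun (z : l2) : I -> C := val z.
Coercion l2fun : l2 >-> Funclass.
Implicit Types (u v w z : l2).

Lemma l2P z : sqsum z. Proof. by apply/asboolP/(valP z). Qed.

Definition mk_l2 f (h : sqsum f) : l2 := exist _ f (asboolT h).

Lemma l2_ext u v : (forall i, u i = v i) -> u = v.
Proof. by move=> uv; apply: val_inj; apply: funext. Qed.

Lemma l2_linE a u v i : (a *: u + v : l2) i = a * u i + v i. Proof. by []. Qed.
Lemma l2_scaleE a u i : (a *: u : l2) i = a * u i. Proof. by []. Qed.
Lemma l2_addE u v i : (u + v : l2) i = u i + v i. Proof. by []. Qed.
Lemma l2_subE u v i : (u - v : l2) i = u i - v i. Proof. by []. Qed.

Lemma l2_sumE (J : Type) (r : seq J) (P : pred J) (F : J -> l2) i :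
  (\sum_(j <- r | P j) F j : l2) i = \sum_(j <- r | P j) F j i.
Proof. by elim/big_rec2: _ => // j x y _ <-; rewrite l2_addE. Qed.

Lemma sqr_norm_cvg u : exists l, sums_to (fun i => `|u i| ^+ 2) l.
Proof.
have [M uM] := l2P u.
by have [l [ul _ _]] := bounded_sums_cvg (sqr_norm_ge0 u) uM; exists l.
Qed.

(** By polarization the products are a combination of four families of squared
    moduli, and these converge by monotone convergence. *)
Lemma dot_cvg u v : exists l, sums_to (fun i => u i * (v i)^*) l.
Proof.
have [a ha] := sqr_norm_cvg (u + v); have [b hb] := sqr_norm_cvg (u - v).
have [c hc] := sqr_norm_cvg (u + 'i *: v).
have [d hd] := sqr_norm_cvg (u - 'i *: v).
have h0 : sums_to (fun i : I => 0 : C) 0.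
  by have := @sums_to_finite R I (fun=> 0) [::] isT; rewrite big_nil; apply.
eexists.
have := sums_to_lin (4^-1) ha (sums_to_lin (- 4^-1) hb
  (sums_to_lin ('i / 4) hc (sums_to_lin (- 'i / 4) hd h0))).
congr sums_to; apply: funext => i.
rewrite !l2_subE !l2_addE !l2_scaleE !normCK !(rmorphB, rmorphD, rmorphM).
rewrite /= conjCi.
have i2 : 'i * 'i = -1 :> C by rewrite -expr2 sqrCi.
set x := u i; set y := v i; set x' := x^*; set y' := y^*.
have -> : (x + 'i * y) * (x' + - 'i * y') =
   x * x' - ('i * 'i) * (y * y') + 'i * (y * x' - x * y') by ring.
have -> : (x - 'i * y) * (x' - - 'i * y') =
   x * x' - ('i * 'i) * (y * y') - 'i * (y * x' - x * y') by ring.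
rewrite i2.
(* In the two squares with 'i, t is the common part and t' the part that changes
   sign. *)
have -> (t t' : C) : 4^-1 * ((x + y) * (x' + y')) +
  (- 4^-1 * ((x - y) * (x' - y')) +
  ('i / 4 * (t + 'i * t') + (- 'i / 4 * (t - 'i * t') + 0))) =
  2 / 4 * (x * y' + y * x') + ('i * 'i) * (2 / 4) * t' by ring.
by rewrite i2; field.
Qed.

Definition l2dot u v : C := xget 0 [set l | sums_to (fun i => u i * (v i)^*) l].

Lemma l2dotP u v : sums_to (fun i => u i * (v i)^*) (l2dot u v).
Proof. exact: (xgetPex 0 (dot_cvg u v)). Qed.

Lemma l2dot_hermitian u v : l2dot u v = (-1) ^+ false * (l2dot v u)^*.
Proof.
rewrite expr0 mul1r; apply: sums_to_unique (l2dotP u v) _.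
have := sums_to_conj (l2dotP v u).
by congr sums_to; apply: funext => i; rewrite rmorphM /= conjCK mulrC.
Qed.

Lemma l2dot_linl a u u' v : l2dot (a *: u + u') v = a * l2dot u v + l2dot u' v.
Proof.
apply: sums_to_unique (l2dotP _ _) _.
have := sums_to_lin a (l2dotP u v) (l2dotP u' v).
by congr sums_to; apply: funext => i; rewrite l2_linE mulrDl mulrA.
Qed.

Lemma l2dot_bilinear : bilinear_for *%R (Num.conj \; *%R) l2dot.
Proof.
split=> u a v w /=; first exact: l2dot_linl.
rewrite !(l2dot_hermitian u) !expr0 !mul1r l2dot_linl.
by rewrite rmorphD rmorphM.
Qed.

HB.instance Definition _ :=
  bilinear_isBilinear.Build C l2 l2 C *%R (Num.conj \; *%R)
    l2dot l2dot_bilinear.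
HB.instance Definition _ :=
  isHermitianSesquilinear.Build C l2 false Num.conj l2dot l2dot_hermitian.

Lemma l2dot_bounded u : bounded_sums (fun i => `|u i| ^+ 2) (l2dot u u).
Proof.
have [M uM] := l2P u; apply: (sums_to_bounded (sqr_norm_ge0 u) uM _).1.
have := l2dotP u u; congr sums_to; apply: funext => i; exact/esym/normCK.
Qed.

Lemma l2dot_le u M : bounded_sums (fun i => `|u i| ^+ 2) M -> l2dot u u <= M.
Proof.
move=> uM; apply: (sums_to_bounded (sqr_norm_ge0 u) uM _).2.
have := l2dotP u u; congr sums_to; apply: funext => i; exact/esym/normCK.
Qed.

Lemma l2_coord_le u i : `|u i| ^+ 2 <= l2dot u u.
Proof. by have := @l2dot_bounded u [:: i] isT; rewrite big_seq1. Qed.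

Lemma l2dot_gt0 u : u != 0 -> 0 < l2dot u u.
Proof.
move=> u0; have [i ui] : exists i, u i <> 0.
  apply: contrapT => h; move/eqP: u0; apply; apply: l2_ext => i.
  by apply: contrapT => ui; apply: h; exists i.
apply: lt_le_trans (l2_coord_le u i); rewrite exprn_gt0 // normr_gt0.
exact/eqP.
Qed.

HB.instance Definition _ := isDotProduct.Build C l2 l2dot l2dot_gt0.

Definition l2_preHilbert : preHilbert R := @PreHilbert R l2 l2dot.

Lemma l2dot_finite u v s : uniq s ->
  (forall i, u i * (v i)^* <> 0 -> i \in s) ->
  l2dot u v = \sum_(i <- s) u i * (v i)^*.
Proof.
move=> us h; apply: sums_to_unique (l2dotP u v) _.
exact: sums_to_finite.
Qed.

End SquareSummable.

(** * Completeness *)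

Section Completeness.
Variable R : realType.
Local Notation C := R[i].

(** The limit is the limit inferior, written as the supremum of the eventual
    lower bounds. *)
Lemma real_cauchy (u : nat -> R) :
  (forall e, 0 < e -> exists N, forall m n, (N <= m)%N -> (N <= n)%N ->
     `|u m - u n| < e) ->
  exists l, forall e, 0 < e -> exists N, forall n, (N <= n)%N -> `|u n - l| < e.
Proof.
move=> cu; pose A := [set x | exists N, forall n, (N <= n)%N -> x <= u n].
have lowA e N : (forall m n, (N <= m)%N -> (N <= n)%N -> `|u m - u n| < e) ->
    A (u N - e).
  move=> h; exists N => n Nn; have := h N n (leqnn _) Nn.
  by rewrite ltr_distl => /andP[_ /ltW]; rewrite lerBlDr.
have upA e N : (forall m n, (N <= m)%N -> (N <= n)%N -> `|u m - u n| < e) ->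
    ubound A (u N + e).
  move=> h x [N' h']; have := h N (maxn N N') (leqnn _) (leq_maxl _ _).
  rewrite ltr_distl => /andP[/ltW + _]; rewrite lerBlDr => k.
  by apply: le_trans (h' (maxn N N') (leq_maxr _ _)) _; lra.
have [N1 h1] := cu 1 ltr01.
have supA : has_sup A.
  by split; [exists (u N1 - 1); apply: lowA | exists (u N1 + 1); apply: upA].
exists (sup A) => e e0; have e2 : 0 < e / 2 by rewrite divr_gt0.
have [N h] := cu _ e2; exists N => n Nn.
have hl : u N - e / 2 <= sup A by apply: ub_le_sup; [case: supA | apply: lowA].
have hu : sup A <= u N + e / 2 by apply: ge_sup; [case: supA | apply: upA].
have := h n N Nn (leqnn _); rewrite !ltr_distl => /andP[]; lra.
Qed.

Lemma complex_cauchy (u : nat -> C) :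
  (forall e, 0 < e -> exists N, forall m n, (N <= m)%N -> (N <= n)%N ->
     `|u m - u n| < e) ->
  exists l, forall e, 0 < e -> exists N, forall n, (N <= n)%N -> `|u n - l| < e.
Proof.
move=> cu.
have ReB (x y : C) : complex.Re (x - y) = complex.Re x - complex.Re y.
  by case: x y => ? ? [].
have ImB (x y : C) : complex.Im (x - y) = complex.Im x - complex.Im y.
  by case: x y => ? ? [].
have Im_le (z : C) : `|complex.Im z|%:C%C <= `|z|.
  by rewrite normc_def lecR -sqrtr_sqr ler_wsqrtr // lerDr sqr_ge0.
have norm_le (z : C) : `|z| <= (`|complex.Re z| + `|complex.Im z|)%:C%C.
  rewrite [z in `|z|]complexE (le_trans (ler_normD _ _)) // rmorphD normrM.
  by rewrite normCi mul1r !normc_def /= !expr0n /= !addr0 !sqrtr_sqr.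
have [|a ha] := @real_cauchy (fun n => complex.Re (u n)).
  move=> e e0; have eC : 0 < e%:C%C :> C by rewrite ltcR.
  have [N h] := cu _ eC.
  exists N => m n Nm Nn; rewrite -ReB -ltcR.
  exact: le_lt_trans (normc_ge_Re _) (h _ _ Nm Nn).
have [|b hb] := @real_cauchy (fun n => complex.Im (u n)).
  move=> e e0; have eC : 0 < e%:C%C :> C by rewrite ltcR.
  have [N h] := cu _ eC.
  exists N => m n Nm Nn; rewrite -ImB -ltcR.
  exact: le_lt_trans (Im_le _) (h _ _ Nm Nn).
exists (a +i* b)%C => e e0.
have eR : (complex.Re e)%:C%C = e by rewrite RRe_real ?ger0_real ?ltW.
have e2 : 0 < complex.Re e / 2 by rewrite divr_gt0 // -ltcR eR.
have [N h] := ha _ e2; have [N' h'] := hb _ e2.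
exists (maxn N N') => n; rewrite geq_max => /andP[Nn Nn'].
rewrite (le_lt_trans (norm_le _)) // -eR ltcR ReB ImB [ltRHS]splitr /=.
by rewrite ltrD ?h ?h'.
Qed.

Variable I : choiceType.

(** The limit is taken coordinatewise.  Its distance to [u n] is controlled on
    each finite set of coordinates by going through a term [u m], with [m] so
    large (depending on the finite set) that [u m] is close to the limit there;
    the resulting bound does not depend on the finite set. *)
Lemma l2_complete : complete_space (l2_preHilbert R I).
Proof.
move=> u cu.
have sqr_lt (x e : C) : 0 < e -> `|x| ^+ 2 < e ^+ 2 -> `|x| < e.
  by move=> e0; rewrite ltr_pXn2r // nnegrE ?normr_ge0 ?ltW.
have cvg_coord i : exists l : C, forall e : C, 0 < e ->
    exists N, forall n, (N <= n)%N -> `|(u n : l2 R I) i - l| < e.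
  apply: complex_cauchy => e e0.
  have [N h] := cu _ (exprn_gt0 2 e0); exists N => m n Nm Nn.
  apply: sqr_lt => //; apply: le_lt_trans (h m n Nm Nn).
  exact: (l2_coord_le (u m - u n : l2 R I)).
have [l hl] := choice cvg_coord.
have cvg_sum s (e : C) : 0 < e -> exists N, forall n, (N <= n)%N ->
    \sum_(i <- s) `|(u n : l2 R I) i - l i| ^+ 2 < e.
  elim: s e => [|i s IH] e e0; first by exists 0%N => n _; rewrite big_nil.
  have e2 : 0 < e / 2 by rewrite divr_gt0 ?ltr0n.
  have [N h] := IH _ e2.
  have es : 0 < sqrtC (e / 2) by rewrite sqrtC_gt0.
  have [N' h'] := hl i _ es.
  exists (maxn N N') => n; rewrite geq_max => /andP[Nn Nn'].
  rewrite big_cons [e]splitr ltrD ?h // -[ltRHS]sqrtCK ltr_pXn2r ?h' //.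
    by rewrite nnegrE normr_ge0.
  by rewrite nnegrE ltW.
have close (e : C) : 0 < e -> exists N, forall n, (N <= n)%N ->
    bounded_sums (fun i => `|(u n : l2 R I) i - l i| ^+ 2) e.
  move=> e0; have e4 : 0 < e / 4 by rewrite divr_gt0 ?ltr0n.
  have [N h] := cu _ e4; exists N => n Nn s us.
  have [N' h'] := cvg_sum s _ e4; pose m := maxn N N'.
  apply: (@le_trans _ _ (2 * (\sum_(i <- s) `|(u n - u m : l2 R I) i| ^+ 2 +
                        \sum_(i <- s) `|(u m : l2 R I) i - l i| ^+ 2))).
    rewrite -big_split mulr_sumr; apply: ler_sum => i _ /=.
    by have := sqr_normD_le ((u n - u m : l2 R I) i) ((u m : l2 R I) i - l i);
      rewrite l2_subE addrA subrK.
  have -> : e = 2 * (e / 4 + e / 4) by field.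
  rewrite ler_wpM2l // lerD //; last by apply/ltW/h'; rewrite leq_maxr.
  apply: le_trans (l2dot_bounded _ us) _.
  by apply/ltW/h; rewrite ?leq_maxl.
have sq1 : exists n, sqsum (fun i => (u n : l2 R I) i - l i).
  by have [N h] := close 1 ltr01; exists N, 1; apply: h.
have sql : sqsum l.
  have [n hn] := sq1; have := sqsum_lin (-1) hn (l2P (u n)).
  by congr sqsum; apply: funext => i; rewrite scaleN1r /= opprB subrK.
exists (mk_l2 sql : l2 R I) => e e0.
have e2 : 0 < e / 2 by rewrite divr_gt0 ?ltr0n.
have [N h] := close _ e2; exists N => n Nn.
apply: le_lt_trans (_ : _ <= e / 2) _; last first.
  by rewrite ltr_pdivrMr ?ltr0n // ltr_pMr // ltr1n.
by apply: l2dot_le => s us; apply: h.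
Qed.

Definition l2_hilbert : hilbert R := Hilbert l2_complete.

End Completeness.

(** * Finitely supported vectors *)

Section Finite.
Variables (R : realType) (I : choiceType).
Local Notation C := R[i].
Local Notation l2 := (l2 R I).
Local Notation V := (l2_preHilbert R I).
Implicit Types (s : seq I) (P Q : set I) (u v z : l2).

Lemma delta_finite (i j : I) : ((j == i)%:R : C) <> 0 -> j \in [:: i].
Proof. by rewrite inE; case: eqP. Qed.

Definition delta i : l2 := mk_l2 (sqsum_finite (@delta_finite i)).

Lemma deltaE i j : delta i j = (j == i)%:R. Proof. by []. Qed.

Lemma dot_deltar u i : l2dot u (delta i) = u i.
Proof.
rewrite (@l2dot_finite _ _ _ _ [:: i]) //.
  by rewrite big_seq1 deltaE eqxx rmorph1 mulr1.
move=> j; rewrite deltaE inE; case: eqP => // _.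
by rewrite rmorph0 mulr0.
Qed.

Lemma l2dot_ge0 u : 0 <= l2dot u u.
Proof. by have := l2dot_bounded u (isT : uniq [::]); rewrite big_nil. Qed.

Lemma dot_deltal u i : l2dot (delta i) u = (u i)^*.
Proof. by rewrite l2dot_hermitian expr0 mul1r dot_deltar. Qed.

(** The algebraic span of the basis vectors with index in [P] (see
    [fin_expand]). *)
Definition fin_set P : set V := [set z : l2 |
  (exists s, forall i, z i <> 0 -> i \in s) /\ forall i, z i <> 0 -> P i].

Lemma fin_set_subspace P : lin_subspace (fin_set P).
Proof.
split=> [|a u v [[s us] uP] [[t vt] vP]]; first by split; [exists [::] |].
have h i : (a *: u + v : l2) i <> 0 -> (u : l2) i <> 0 \/ (v : l2) i <> 0.
  rewrite l2_linE => nz; have [u0|] := pselect ((u : l2) i = 0); last by left.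
  by right=> v0; apply: nz; rewrite u0 v0 mulr0 addr0.
split; last by move=> i /h[/uP|/vP].
by exists (s ++ t) => i /h[/us|/vt]; rewrite mem_cat => ->; rewrite ?orbT.
Qed.

Lemma fin_setS P Q : P `<=` Q -> fin_set P `<=` fin_set Q.
Proof. by move=> PQ z [zs zP]; split=> // i /zP /PQ. Qed.

Lemma delta_fin P i : P i -> fin_set P (delta i).
Proof.
move=> Pi; split; first by exists [:: i]; apply: delta_finite.
by move=> j /delta_finite; rewrite inE => /eqP ->.
Qed.

Lemma fin_expand P z : fin_set P z -> exists s, [/\ uniq s,
  forall i, z i <> 0 -> i \in s, forall i, i \in s -> P i
  & z = \sum_(i <- s) z i *: delta i].
Proof.
move=> [[s zs] zP]; exists [seq i <- undup s | z i != 0]; split=> [|i zi|i|].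
- exact/filter_uniq/undup_uniq.
- by rewrite mem_filter mem_undup zs // andbT; apply/eqP.
- by rewrite mem_filter => /andP[/eqP/zP].
apply: l2_ext => i; rewrite l2_sumE.
under eq_bigr do rewrite l2_scaleE deltaE.
have [zi|zi] := pselect (z i = 0).
  rewrite zi big1_seq // => j /andP[_ ]; rewrite mem_filter => /andP[/eqP zj _].
  by case: eqP => [ij|]; rewrite ?mulr0 // -ij in zj *.
rewrite (bigD1_seq i) ?filter_uniq ?undup_uniq //=; last first.
  by rewrite mem_filter mem_undup zs // andbT; apply/eqP.
rewrite eqxx mulr1 big1 ?addr0 // => j /negPf; rewrite eq_sym => ->.
by rewrite mulr0.
Qed.

Lemma lin_subspace_sum (W : preHilbert R) (A : set W) (J : eqType) (r : seq J)
    (x : J -> W) :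
  lin_subspace A -> (forall j, j \in r -> A (x j)) -> A (\sum_(j <- r) x j).
Proof.
move=> [A0 AZ] Ax; rewrite big_seq; elim/big_rec: _ => // j z jr Az.
by rewrite -[x j]scale1r; apply: AZ => //; apply: Ax.
Qed.

Lemma lin_subspaceZ (W : preHilbert R) (A : set W) (a : C) (z : W) :
  lin_subspace A -> A z -> A (a *: z).
Proof. by move=> [A0 AZ] Az; rewrite -[_ *: _]addr0; apply: AZ. Qed.

Lemma fin_set_sub P (A : set V) : lin_subspace A ->
  (forall i, P i -> A (delta i)) ->
  fin_set P `<=` A.
Proof.
move=> As AP z /fin_expand[s [us zs sP ->]].
apply: (lin_subspace_sum As) => i si.
exact/(lin_subspaceZ _ As)/AP/sP.
Qed.

(** Cut the vector off outside a finite set that carries all but [e] of its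
    squared norm. *)
Lemma fin_dense z : norm_closure (fin_set setT) (z : V).
Proof.
move=> e e0; have [s0 h] := l2dotP z z e0.
have us := undup_uniq s0; set s := undup s0 in us.
pose a : V := \sum_(i <- s) z i *: delta i.
have aE i : (a : l2) i = if i \in s then z i else 0.
  rewrite l2_sumE; under eq_bigr do rewrite l2_scaleE deltaE.
  case: ifP => si.
    rewrite (bigD1_seq i) //= eqxx mulr1 big1 ?addr0 // => j /negPf.
    by rewrite eq_sym => ->; rewrite mulr0.
  rewrite big1_seq // => j /= sj.
  by have [ij|_] := eqVneq i j; [rewrite -ij si in sj | rewrite mulr0].
exists a.
  split=> //; exists s => i; rewrite aE; by case: ifP.
have := h s us (fun i => _); rewrite distrC => /(_ _)/idP {}h.
have {}h : `|l2dot z z - \sum_(i <- s) z i * (z i)^*| < e.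
  by apply: h => i; rewrite mem_undup.
have hr : l2dot z z - \sum_(i <- s) z i * (z i)^* < e.
  apply: le_lt_trans h; apply: real_ler_norm.
  rewrite rpredB ?ger0_real ?l2dot_ge0 //.
  by apply: sumr_ge0 => i _; rewrite -normCK exprn_ge0.
apply: le_lt_trans hr; apply: l2dot_le => t ut; rewrite lerBrDr.
under [X in _ + X <= _]eq_bigr do rewrite -normCK.
apply: le_trans (l2dot_bounded z (_ : uniq ([seq i <- t | i \notin s] ++ s))).
  rewrite big_cat big_filter /= lerD2r.
  rewrite (bigID (mem s)) /= big1 ?add0r => [|i si]; last first.
    by rewrite l2_subE aE si subrr normr0 expr0n.
  by apply: ler_sum => i /negPf si; rewrite l2_subE aE si subr0.
rewrite cat_uniq us andbT filter_uniq //=; apply/hasPn => i si.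
by rewrite mem_filter /= si.
Qed.

(** The linear map sending the basis vector of index [i] to [F i].  It is
    meaningful, and linear, on the vectors for which only finitely many terms
    are nonzero; these need not be finitely supported, as [F] may vanish. *)
Definition lin_ext (W : lmodType C) (F : I -> W) (z : l2) : W :=
  \sum_(i \in [set: I]) z i *: F i.

Definition lin_ext_dom (W : lmodType C) (F : I -> W) (z : l2) : Prop :=
  exists s, forall i, z i *: F i <> 0 -> i \in s.

Section LinExt.
Variables (W : lmodType C) (F : I -> W).

Lemma lin_extE z s : uniq s -> (forall i, z i *: F i <> 0 -> i \in s) ->
  lin_ext F z = \sum_(i <- s) z i *: F i.
Proof.
move=> us zs; rewrite /lin_ext (fsbigE s) //; last first.
  by move=> i _ si; apply: contrapT => /zs; rewrite (negPf si).
by apply: eq_bigl => i; rewrite in_setT.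
Qed.

Lemma lin_ext_linear a u v : lin_ext_dom F u -> lin_ext_dom F v ->
  lin_ext F (a *: u + v) = a *: lin_ext F u + lin_ext F v.
Proof.
move=> [s us] [t vt]; have uu := undup_uniq (s ++ t).
rewrite !(@lin_extE _ (undup (s ++ t))) //.
- rewrite scaler_sumr -big_split; apply: eq_bigr => i _ /=.
  by rewrite l2_linE scalerDl scalerA.
- by move=> i /vt; rewrite mem_undup mem_cat => ->; rewrite orbT.
- by move=> i /us; rewrite mem_undup mem_cat => ->.
- move=> i nz; apply: contrapT; rewrite mem_undup mem_cat => /negP.
  rewrite negb_or => /andP[/negP si /negP ti]; apply: nz.
  rewrite l2_linE scalerDl -scalerA.
  have -> : u i *: F i = 0 by apply: contrapT => /us.
  have -> : v i *: F i = 0 by apply: contrapT => /vt.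
  by rewrite scaler0 addr0.
Qed.

Lemma fin_lin_ext_dom P z : fin_set P z -> lin_ext_dom F z.
Proof.
move=> [[s zs] _]; exists s => i nz; apply: zs => z0.
by apply: nz; rewrite z0 scale0r.
Qed.

Lemma lin_ext_delta i : lin_ext F (delta i) = F i.
Proof.
rewrite (@lin_extE _ [:: i]) ?big_seq1 ?deltaE ?eqxx ?scale1r // => j nz.
by apply: delta_finite => j0; apply: nz; rewrite deltaE j0 scale0r.
Qed.

End LinExt.

Section FinSpace.
Variable P : set I.

Definition fin_pred : pred l2 := fun z => `[< fin_set P z >].

Lemma fin_pred_submod : submod_closed fin_pred.
Proof.
have [h0 hZ] := fin_set_subspace P.
split=> [|a u v /asboolP uP /asboolP vP]; apply/asboolP; first exact: h0.
exact: hZ.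
Qed.

HB.instance Definition _ :=
  GRing.isSubmodClosed.Build C l2 fin_pred fin_pred_submod.

(** The subspace [fin_set P] as a type, to serve as a pre-Hilbert space in its
    own right. *)
Definition finspan := {z : l2 | fin_pred z}.
HB.instance Definition _ := SubType.on finspan.
HB.instance Definition _ := [Choice of finspan by <:].
HB.instance Definition _ := [SubChoice_isSubZmodule of finspan by <:].
HB.instance Definition _ := [SubZmodule_isSubLmodule of finspan by <:].

Definition finspan_val (z : finspan) : l2 := val z.

Lemma finspan_val_linear : linear finspan_val.
Proof. by []. Qed.

HB.instance Definition _ :=
  GRing.isLinear.Build C finspan l2 _ finspan_val finspan_val_linear.

Lemma finspanP (z : finspan) : fin_set P (finspan_val z).
Proof. exact/asboolP/(valP z). Qed.

Definition mk_finspan (z : l2) (h : fin_set P z) : finspan :=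
  exist _ z (asboolT h).

Lemma finspan_val_inj : injective finspan_val.
Proof. exact: val_inj. Qed.

Definition fdot (u v : finspan) : C := l2dot (finspan_val u) (finspan_val v).

Lemma fdot_hermitian (u v : finspan) : fdot u v = (-1) ^+ false * (fdot v u)^*.
Proof. exact: l2dot_hermitian. Qed.

Lemma fdot_bilinear : bilinear_for *%R (Num.conj \; *%R) fdot.
Proof.
by have [l r] := @l2dot_bilinear R I; split=> u a v w; [exact: l|exact: r].
Qed.

Lemma fdot_gt0 (u : finspan) : u != 0 -> 0 < fdot u u.
Proof.
move=> u0; apply: l2dot_gt0; apply: contra_neq u0 => h.
exact: finspan_val_inj.
Qed.

HB.instance Definition _ :=
  bilinear_isBilinear.Build C finspan finspan C *%R (Num.conj \; *%R)
    fdot fdot_bilinear.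
HB.instance Definition _ :=
  isHermitianSesquilinear.Build C finspan false Num.conj fdot fdot_hermitian.
HB.instance Definition _ := isDotProduct.Build C finspan fdot fdot_gt0.

Definition finspan_preHilbert : preHilbert R := @PreHilbert R finspan fdot.

End FinSpace.

End Finite.

(** * Tensor products as concatenation of words *)

Section Words.
Variable R : realType.
Local Notation C := R[i].
Local Notation word := (seq nat).
Local Notation l2 := (l2 R word).
Implicit Types (x z : l2) (w : word).

(** The tensor product of a vector of degree 1 with an arbitrary vector: the
    coefficient at a nonempty word is the product of the coefficients at its
    first letter and at the rest. *)
Definition otimes_fun x z : word -> C :=
  fun w => if w is i :: w' then x [:: i] * z w' else 0.

(** A finite set of nonempty words lies in a product of a finite set of letters
    and a finite set of words, over which a sum of products factors. *)
Lemma cons_allpairs (s : seq word) : uniq s -> exists heads : seq nat,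
  exists2 tails : seq word, uniq heads /\ uniq tails &
  {subset [seq w <- s | w != [::]] <= [seq i :: w | i <- heads, w <- tails]}.
Proof.
move=> us; exists (undup (map (head 0%N) s)); exists (undup (map behead s)).
  by rewrite !undup_uniq.
move=> [|i w]; rewrite mem_filter //= => ws; apply/allpairsP.
exists (i, w); rewrite /= !mem_undup; split=> //.
  exact: (map_f (head 0%N) ws).
exact: (map_f behead ws).
Qed.

Lemma uniq_cons_allpairs (s : seq nat) (t : seq word) : uniq s -> uniq t ->
  uniq [seq i :: w | i <- s, w <- t].
Proof.
by move=> us ut; apply: allpairs_uniq => // -[i w] [j v] _ _ [-> ->].
Qed.

Lemma uniq_letters (s : seq nat) : uniq s -> uniq [seq [:: i] | i <- s].
Proof. by move=> us; rewrite map_inj_uniq // => i j []. Qed.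

(** The norm of a tensor product is at most (in fact equal to) the product of
    the norms; this makes creation operators bounded. *)
Lemma otimes_bounded x z :
  bounded_sums (fun w => `|otimes_fun x z w| ^+ 2) (l2dot x x * l2dot z z).
Proof.
move=> s us; have [hs [ts [uh ut] sub]] := cons_allpairs us.
have uA := uniq_cons_allpairs uh ut.
rewrite (bigID (fun w => w != [::])) /= [X in _ + X]big1 ?addr0; last first.
  by move=> w; rewrite negbK => /eqP ->; rewrite normr0 expr0n.
rewrite -big_filter.
apply: (@le_trans _ _
  (\sum_(w <- [seq i :: w | i <- hs, w <- ts]) `|otimes_fun x z w| ^+ 2)).
  rewrite (sum_extend _ (filter_uniq _ us) uA sub) lerDl sumr_ge0 // => w _.
  by rewrite exprn_ge0.
rewrite big_allpairs_dep /=.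
have -> : \sum_(i <- hs) \sum_(w <- ts) `|x [:: i] * z w| ^+ 2 =
   (\sum_(w <- [seq [:: i] | i <- hs]) `|x w| ^+ 2) *
   (\sum_(w <- ts) `|z w| ^+ 2).
  rewrite big_map mulr_suml; apply: eq_bigr => i _; rewrite mulr_sumr.
  by apply: eq_bigr => w _; rewrite normrM exprMn.
apply: ler_pM; do ?by apply: sumr_ge0 => i _; rewrite exprn_ge0.
  exact/l2dot_bounded/uniq_letters.
exact: l2dot_bounded.
Qed.

Definition otimes x z : l2 := mk_l2 (ex_intro _ _ (@otimes_bounded x z)).

Lemma otimesE x z i w : otimes x z (i :: w) = x [:: i] * z w. Proof. by []. Qed.

Lemma otimes0E x z : otimes x z [::] = 0. Proof. by []. Qed.

Lemma otimes_linl a x x' z :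
  otimes (a *: x + x') z = a *: otimes x z + otimes x' z.
Proof.
apply: l2_ext => -[|i w]; rewrite l2_linE ?otimesE ?otimes0E ?mulr0 ?addr0 //.
by rewrite l2_linE mulrDl mulrA.
Qed.

Lemma otimes_linr x a z z' :
  otimes x (a *: z + z') = a *: otimes x z + otimes x z'.
Proof.
apply: l2_ext => -[|i w]; rewrite l2_linE ?otimesE ?otimes0E ?mulr0 ?addr0 //.
by rewrite l2_linE mulrDr mulrCA.
Qed.

Lemma otimes_delta i w : otimes (delta R [:: i]) (delta R w) = delta R (i :: w).
Proof.
apply: l2_ext => -[|j v]; rewrite ?otimesE !deltaE //= eqseq_cons.
by rewrite -natrM mulnb !eqseq_cons andbT.
Qed.

Lemma otimes0l z : otimes 0 z = 0.
Proof. by apply: l2_ext => -[|i w] //; rewrite otimesE mul0r. Qed.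

Lemma otimes0r x : otimes x 0 = 0.
Proof. by apply: l2_ext => -[|i w] //; rewrite otimesE mulr0. Qed.

Lemma otimes_le x z : l2dot (otimes x z) (otimes x z) <= l2dot x x * l2dot z z.
Proof. exact/l2dot_le/otimes_bounded. Qed.

Definition len n : set word := [set w | size w = n].

Local Notation tp n := (finspan R (len n)).

Lemma otimes_fin x z n : fin_set (len 1) x -> fin_set (len n) z ->
  fin_set (len n.+1) (otimes x z).
Proof.
move=> [[s xs] x1] [[t zt] zn]; split=> [|[|i w]]; last 2 first.
- by [].
- rewrite otimesE => nz; congr S; apply: zn => z0.
  by apply: nz; rewrite z0 mulr0.
exists [seq i :: w | i <- map (head 0%N) s, w <- t] => -[|i w] //.
rewrite otimesE => nz; apply/allpairsP; exists (i, w); split=> //=.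
  by apply: (map_f (head 0%N) (xs [:: i] _)) => x0; apply: nz; rewrite x0 mul0r.
by apply: zt => z0; apply: nz; rewrite z0 mulr0.
Qed.

Definition ftens n (x : tp 1) (z : tp n) : tp n.+1 :=
  mk_finspan (otimes_fin (finspanP x) (finspanP z)).

Lemma ftens_bilinear n : bilinear_for
  (GRing.Scale.Law.clone _ _ *:%R _) (GRing.Scale.Law.clone _ _ *:%R _)
  (@ftens n).
Proof.
by split=> [z|x] a u v; apply: finspan_val_inj;
  [apply: otimes_linl|apply: otimes_linr].
Qed.

HB.instance Definition _ n :=
  bilinear_isBilinear.Build C (tp 1) (tp n) (tp n.+1) _ _
    (@ftens n) (ftens_bilinear n).

Definition basis_word n w : tp n := insubd 0 (delta R w).

Lemma basis_word_val n w : size w = n ->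
  finspan_val (basis_word n w) = delta R w.
Proof.
by move=> wn; apply: insubdK; apply/asboolP/delta_fin.
Qed.

Lemma finspan_ind n (A : tp n -> Prop) :
  A 0 -> (forall a u v, A u -> A v -> A (a *: u + v)) ->
  (forall w, size w = n -> A (basis_word n w)) -> forall z : tp n, A z.
Proof.
move=> A0 AZ Ab z; have [s [us zs sn zE]] := fin_expand (finspanP z).
have -> : z = \sum_(w <- s) finspan_val z w *: basis_word n w.
  apply: finspan_val_inj; rewrite {1}zE linear_sum; apply: eq_big_seq => w ws.
  by rewrite linearZ /= basis_word_val //; apply: sn.
rewrite big_seq; elim/big_rec: _ => // w y ws Ay; apply: AZ => //.
exact/Ab/sn.
Qed.

Lemma ftens_bas n i w : size w = n ->
  ftens (basis_word 1 [:: i]) (basis_word n w) = basis_word n.+1 (i :: w).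
Proof.
move=> wn; apply: finspan_val_inj.
rewrite -[LHS]/(otimes (finspan_val (basis_word 1 [:: i]))
                       (finspan_val (basis_word n w))).
by rewrite !basis_word_val ?otimes_delta //= wn.
Qed.

(** As in any tensor product of spaces with bases, [g] is prescribed on the
    basis words, which are the tensors of a letter and a shorter word. *)
Lemma ftens_universal n (W : lmodType C) (f : {bilinear tp 1 -> tp n -> W}) :
  exists g : {linear tp n.+1 -> W},
    (forall u v, g (ftens u v) = f u v) /\
    (forall g' : {linear tp n.+1 -> W},
       (forall u v, g' (ftens u v) = f u v) -> g' =1 g).
Proof.
pose F w : W :=
  if w is i :: w' then f (basis_word 1 [:: i]) (basis_word n w') else 0.
pose g (z : tp n.+1) : W := lin_ext F (finspan_val z).
have g_lin : linear g.
  by move=> a u v; rewrite /g linearP; apply: lin_ext_linear;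
    apply/fin_lin_ext_dom/finspanP.
pose gL := GRing.isLinear.Build C (tp n.+1) W _ g g_lin.
pose G : {linear tp n.+1 -> W} := HB.pack g gL.
have Gbas w : size w = n.+1 -> G (basis_word n.+1 w) = F w.
  by move=> wn; rewrite /= /g basis_word_val // lin_ext_delta.
have Gtens u v : G (ftens u v) = f u v.
  elim/finspan_ind: u v => [v|a u u' IH IH' v|[|i []] // _ v].
  - by rewrite !linear0l linear0.
  - by rewrite !linearPl linearP IH IH'.
  elim/finspan_ind: v => [|a v v' IH IH'|w wn].
  - by rewrite !linear0r linear0.
  - by rewrite !linearPr linearP IH IH'.
  by rewrite ftens_bas // Gbas //= wn.
exists G; split=> // g' g'tens z.
elim/finspan_ind: z => [|a u v IH IH'|[|i w] // [wn]].
- by rewrite !linear0.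
- by rewrite !linearP IH IH'.
by rewrite -ftens_bas // g'tens Gtens.
Qed.

Lemma ftens_dot n (u u' : tp 1) (v v' : tp n) :
  fdot (ftens u v) (ftens u' v') = fdot u u' * fdot v v'.
Proof.
rewrite /fdot.
have [s [us zs s1 _]] := fin_expand (finspanP u).
have [t [ut zt tn _]] := fin_expand (finspanP v).
pose hs := undup (map (head 0%N) s); have uh : uniq hs := undup_uniq _.
have memh i : [:: i] \in s -> i \in hs.
  by move=> si; rewrite mem_undup; apply: (map_f (head 0%N) si).
rewrite (@l2dot_finite _ _ (finspan_val u) _ [seq [:: i] | i <- hs]).
- rewrite (@l2dot_finite _ _ (finspan_val v) _ t) //; last first.
    by move=> w nz; apply: zt => z0; apply: nz; rewrite z0 mul0r.
  rewrite (@l2dot_finite _ _ (finspan_val (ftens u v)) _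
             [seq i :: w | i <- hs, w <- t]).
  + rewrite big_allpairs_dep big_map mulr_suml. apply: eq_bigr => i _.
    rewrite mulr_sumr; apply: eq_bigr => w _; rewrite !otimesE rmorphM /=.
    by rewrite mulrACA.
  + exact: uniq_cons_allpairs.
  + move=> [|i w]; rewrite ?mul0r // otimesE => nz; apply/allpairsP.
    exists (i, w); split=> //=.
      by apply/memh/zs => z0; apply: nz; rewrite z0 !mul0r.
    by apply: zt => z0; apply: nz; rewrite z0 mulr0 mul0r.
- exact: uniq_letters.
- move=> w nz; have /zs ws : finspan_val u w <> 0.
    by move=> z0; apply: nz; rewrite z0 mul0r.
  have := s1 _ ws; case: w ws {nz} => [|i []] // ws _.
  exact/map_f/memh.
Qed.

End Words.

(** * The full Fock space *)

Section FockSpace.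
Variable R : realType.
Local Notation C := R[i].
Local Notation word := (seq nat).
Local Notation l2 := (l2 R word).
Local Notation V := (l2_preHilbert R word).
Local Notation tp n := (finspan R (len n)).
Local Notation e := (delta R).
Implicit Types (x z : l2) (w : word).

(** A finitely supported vector involves words of finitely many lengths. *)
Lemma graded_fin (P : set word) :
  graded_sum (fun n => fin_set P `&` fin_set (len n)) = fin_set P :> set V.
Proof.
apply/seteqP; split=> [_ [N [x [Px ->]]]|z zP].
  by apply: (lin_subspace_sum (fin_set_subspace R P)) => n _; case: (Px n).
have [[s zs] Pz] := zP.
pose part n w := if size w == n then (z : l2) w else 0.
have part_supp n w : part n w <> 0 -> (z : l2) w <> 0.
  by rewrite /part; case: ifP.
have part_fin n w (h : part n w <> 0) : w \in s := zs _ (part_supp n w h).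
exists (\max_(w <- s) size w).+1, (fun n => mk_l2 (sqsum_finite (@part_fin n))).
split=> [n|].
  split; split; try by [exists s => w; exact: part_fin].
    by move=> w /part_supp/Pz.
  move=> w; change (part n w <> 0 -> size w = n).
  by rewrite /part; case: ifP => [/eqP|_] // .

apply: l2_ext => w; rewrite l2_sumE /= /part.
rewrite -big_mkcond /=.
have [z0|/zs ws] := pselect ((z : l2) w = 0); first by rewrite z0 big1.
have wN : (size w < (\max_(w <- s) size w).+1)%N.
  by rewrite ltnS; exact: (@leq_bigmax_seq _ s xpredT size w).
by rewrite (big_pred1 (Ordinal wN)) // => n; rewrite eq_sym.
Qed.

Lemma range_finspan n :
  range (@finspan_val R word (len n)) = fin_set (len n) :> set V.
Proof.
apply/seteqP; split=> [_ [z _ <-]|z zn]; first exact: finspanP.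
by exists (mk_finspan zn).
Qed.

Definition word_vac : tp 0 := mk_finspan (@delta_fin R word (len 0) [::] erefl).

Lemma word_vac_unit : fdot word_vac word_vac = 1.
Proof. by rewrite /fdot dot_deltar deltaE. Qed.

Lemma word_vac_span (X : tp 0) : exists a : C, X = a *: word_vac.
Proof.
exists (finspan_val X [::]); apply: finspan_val_inj; apply: l2_ext => w.
rewrite linearZ l2_scaleE deltaE; case: eqP => [->|wn]; first by rewrite mulr1.
rewrite mulr0; apply: contrapT => /(finspanP X).2; case: w wn => //.
Qed.

Lemma word_orthogonal m n (X : tp m) (Y : tp n) :
  m <> n -> l2dot (finspan_val X) (finspan_val Y) = 0.
Proof.
move=> mn; rewrite (@l2dot_finite _ _ _ _ [::]) ?big_nil // => w nz.
have wm : size w = m.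
  by apply: (finspanP X).2 => x0; apply: nz; rewrite x0 mul0r.
have wn : size w = n.
  by apply: (finspanP Y).2 => y0; apply: nz; rewrite y0 rmorph0 mulr0.
by case: mn; rewrite -wm -wn.
Qed.

Lemma graded_range :
  graded_sum (fun n => range (@finspan_val R word (len n)) : set V) =
  fin_set setT.
Proof.
rewrite -(graded_fin setT); congr graded_sum; apply: funext => n.
rewrite range_finspan.
by apply/seteqP; split=> [z zn|? []//]; split=> //; apply: fin_setS zn.
Qed.

Lemma word_dense (z : V) :
  norm_closure
    (graded_sum (fun n => range (@finspan_val R word (len n)) : set V)) z.
Proof. by rewrite graded_range; apply: fin_dense. Qed.

Definition word_cre (x : tp 1) (z : l2) : l2 := otimes (finspan_val x) z.

Lemma word_cre_linear (x : tp 1) : linear (word_cre x).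
Proof. by move=> a u v; apply: otimes_linr. Qed.

HB.instance Definition _ (x : tp 1) :=
  GRing.isLinear.Build C l2 l2 _ (word_cre x) (word_cre_linear x).

Lemma word_cre_bounded (x : tp 1) : exists M : C,
  forall z, l2dot (word_cre x z) (word_cre x z) <= M * l2dot z z.
Proof. by exists (fdot x x) => z; apply: otimes_le. Qed.

Lemma ftens_tensor n : @is_tensor_product R (finspan_preHilbert R (len 1))
  (finspan_preHilbert R (len n)) (finspan_preHilbert R (len n.+1)) (@ftens R n).
Proof.
split; first exact: ftens_universal.
exact: ftens_dot.
Qed.

Definition one_particle : preHilbert R := finspan_preHilbert R (len 1).

Definition wordFock : fullFock one_particle := @FullFock R one_particle
  (fun n => finspan_preHilbert R (len n)) word_vac word_vac_unit word_vac_span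
  (@ftens R) ftens_tensor (l2_hilbert R word)
  (fun n => @finspan_val R word (len n))
  (fun n X Y => erefl) word_orthogonal word_dense word_cre
  (fun (x : tp 1) n X => erefl) word_cre_bounded.

End FockSpace.

(** * Weighted operators on words and their adjoints *)

Section Squeezing.
Variable R : realType.
Local Notation C := R[i].
Local Notation word := (seq nat).
Local Notation l2 := (l2 R word).
Local Notation V := (l2_preHilbert R word).
Local Notation F := (wordFock R).
Local Notation e := (delta R).
Implicit Types (x z : l2) (w : word) (c : word -> C) (a b : nat -> C).

Lemma algFock_fin : @algFock R _ F = fin_set setT.
Proof. exact: graded_range. Qed.

Lemma vacE : @vac R _ F = e [::]. Proof. by []. Qed.

(** Indices of a basis of the pre-Fock subspace. *)
Definition range_word : set word :=
  [set w | w = [::] \/ (exists n, w = [:: n]) \/ w = [:: 0%N; 0%N]].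

(** Indices of the basis words on which the squeezing can be nonzero. *)
Definition dom_word : set word :=
  [set w | w = [::] \/ (exists n, w = [:: n]) \/ exists n, w = [:: 0%N; n]].

(** The word onto which the squeezing moves a basis word, up to a factor.  Only
    its values on words of length at most 2 matter; the continuation to longer
    words is chosen so that [collapse (i :: w)] and [collapse (i :: collapse w)]
    always agree. *)
Definition collapse w : word :=
  if (size w <= 1)%N then w else nseq (size w) 0%N.

Definition coef a b w : C :=
  match w with
  | [::] => 1
  | [:: n] => a n
  | [:: i; n] => if i == 0%N then b n else 0
  | _ => 0
  end.

(** The operators described at the top: [weighted (coef a b)] is the squeezing
    with parameters a and b. *)
Definition weighted c : V -> V := lin_ext (fun w => c w *: e (collapse w)).

(** Weaker than finite support: the domains in play contain vectors with
    infinitely many nonzero coordinates, but only at words that do not interact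
    with the squeezing. *)
Definition fin_on (A : set word) : set V :=
  [set z | exists s : seq word, forall w, A w -> (z : l2) w <> 0 -> w \in s].

Lemma fin_on_subspace A : lin_subspace (fin_on A).
Proof.
split=> [|k u v [s us] [t vt]]; first by exists [::].
exists (s ++ t) => w Aw; rewrite l2_linE mem_cat => nz.
have [u0|u0] := pselect ((u : l2) w = 0); last by rewrite us.
by rewrite vt ?orbT // => v0; apply: nz; rewrite u0 v0 mulr0 addr0.
Qed.

Lemma fin_fin_on P A z : fin_set P z -> fin_on A z.
Proof. by move=> [[s zs] _]; exists s => w _; apply: zs. Qed.

Lemma coef_dom a b w : coef a b w <> 0 -> dom_word w.
Proof.
case: w => [|i [|j [|k w]]] /= nz; first by left.
- by right; left; exists i.
- by case: i nz => [|i] nz; [right; right; exists j | case: nz].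
- by case: i nz => [|i] [].
Qed.

Lemma collapse_dom w : dom_word w -> range_word (collapse w).
Proof.
case=> [->|[[n ->]|[n ->]]]; rewrite /range_word /collapse /=; first by left.
  by right; left; exists n.
by right; right.
Qed.

Lemma size_collapse w : size (collapse w) = size w.
Proof. by rewrite /collapse; case: ifP; rewrite ?size_nseq. Qed.

Section Weighted.
Variable c : word -> C.
Hypothesis c_dom : forall w, c w <> 0 -> dom_word w.

Lemma weighted_dom z : fin_on dom_word z ->
  lin_ext_dom (fun w => c w *: e (collapse w)) z.
Proof.
move=> [s zs]; exists s => w nz; apply: zs => [|z0].
  by apply: c_dom => c0; apply: nz; rewrite c0 scale0r scaler0.
by apply: nz; rewrite z0 scale0r.
Qed.

Lemma weighted_linear k (u v : V) : fin_on dom_word u -> fin_on dom_word v ->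
  weighted c (k *: u + v) = k *: weighted c u + weighted c v.
Proof. by move=> /weighted_dom hu /weighted_dom hv; apply: lin_ext_linear. Qed.

Lemma weighted_delta w : weighted c (e w) = c w *: e (collapse w).
Proof. exact: lin_ext_delta. Qed.

Lemma weightedE z : fin_on dom_word z -> exists s, [/\ uniq s,
  (forall w, c w * z w <> 0 -> w \in s) &
  weighted c z = \sum_(w <- s) (c w * z w) *: e (collapse w)].
Proof.
move=> [s zs]; exists (undup s).
have cz w : c w * z w <> 0 -> w \in undup s.
  move=> nz; rewrite mem_undup; apply: zs => [|z0].
    by apply: c_dom => c0; apply: nz; rewrite c0 mul0r.
  by apply: nz; rewrite z0 mulr0.
split=> //; first exact: undup_uniq.
rewrite /weighted (@lin_extE _ _ _ _ _ (undup s)) ?undup_uniq //.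
  by apply: eq_bigr => w _; rewrite scalerA mulrC.
move=> w nz; apply: cz => cz0; apply: nz.
by rewrite scalerA mulrC cz0 scale0r.
Qed.

Lemma weighted_fin P z : fin_on dom_word z ->
  (forall w, dom_word w -> z w <> 0 -> P (collapse w)) ->
  fin_set P (weighted c z).
Proof.
move=> zf zP; have [s [_ _ ->]] := weightedE zf.
apply: (lin_subspace_sum (fin_set_subspace R P)) => w _.
have [cz0|nz] := pselect (c w * z w = 0).
  by rewrite cz0 scale0r; case: (fin_set_subspace R P).
apply: (lin_subspaceZ _ (fin_set_subspace R P)); apply/delta_fin/zP.
  by apply: c_dom => c0; apply: nz; rewrite c0 mul0r.
by move=> z0; apply: nz; rewrite z0 mulr0.
Qed.

Lemma weighted_eq0 z : (forall w, dom_word w -> z w = 0) -> weighted c z = 0.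
Proof.
move=> z0; rewrite /weighted (@lin_extE _ _ _ _ _ [::]) ?big_nil // => w nz.
exfalso; apply: nz.
have [c0|/c_dom/z0 ->] := pselect (c w = 0); last by rewrite scale0r.
by rewrite c0 scale0r scaler0.
Qed.

Lemma weightedZ k (u : V) : fin_on dom_word u ->
  weighted c (k *: u) = k *: weighted c u.
Proof.
move=> hu; rewrite -[k *: u]addr0 weighted_linear //.
  by rewrite [weighted c 0]weighted_eq0 ?addr0.
by exists [::] => w _; case.
Qed.

(** The formal adjoint of [weighted c], written in coordinates. *)
Definition coadj_fun z : word -> C := fun w => (c w)^* * z (collapse w).
Definition coadj z : l2 := insubd (0 : l2) (coadj_fun z).

Hypothesis c_sqsum : sqsum (fun n : nat => c [:: 0%N; n]).

(** The vector that represents the functional of degree 2. *)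
Definition pair_weights : word -> C :=
  fun w => if w is [:: 0%N; n] then (c w)^* else 0.

Lemma sqsum_pair_weights : sqsum pair_weights.
Proof.
have [M cM] := c_sqsum; exists M => s us.
pose J n : word := [:: 0%N; n].
pose t := undup (map (nth 0%N ^~ 1%N) s).
have ut : uniq (map J t) by rewrite map_inj_uniq ?undup_uniq // => i j [].
pose p : pred word := fun w => if w is [:: 0%N; n] then true else false.
rewrite (bigID p) /= [X in _ + X]big1 ?addr0; last first.
  move=> w; rewrite /pair_weights.
  by case: w => [|[|i] [|j [|k w]]] //= _; rewrite normr0 expr0n.
rewrite -big_filter.
apply: (@le_trans _ _ (\sum_(w <- map J t) `|pair_weights w| ^+ 2)).
  rewrite (@sum_extend _ _ (filter p s) (map J t)) ?filter_uniq //.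
    by rewrite lerDl sumr_ge0 // => w _; rewrite exprn_ge0.
  move=> w; rewrite mem_filter => /andP[].
  case: w => [|[|i] [|j [|k w]]] //= _ ws; apply: (map_f J).
  by rewrite mem_undup; apply: (map_f (nth 0%N ^~ 1%N) ws).
rewrite big_map /=; under eq_bigr do rewrite norm_conjC.
by apply: cM; apply: undup_uniq.
Qed.

(** The formal adjoint of [z] splits into a part in degrees 0 and 1, which is
    finitely supported because [z] is so there, and a multiple of the vector
    representing the functional of degree 2. *)
Lemma coadj_sqsum z : fin_on range_word z -> sqsum (coadj_fun z).
Proof.
move=> [s zs].
pose low w := if (size w <= 1)%N then (c w)^* * z w else 0.
have slow : sqsum low.
  apply: (@sqsum_finite _ _ _ s) => w; rewrite /low; case: ifP => // sw nz.
  apply: zs => [|z0]; last by apply: nz; rewrite z0 mulr0.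
  by case: w sw {nz} => [|n []] // _; [left|right; left; exists n].
have := sqsum_lin (z [:: 0%N; 0%N]) sqsum_pair_weights slow.
congr sqsum; apply: funext => w.
rewrite /coadj_fun /low /pair_weights /collapse.
rewrite -[LHS]/(_ * _ + _) /=.
have [c0|/c_dom] := pselect (c w = 0).
  case: w c0 => [|[|i] [|j [|k w]]] //= ->;
    by rewrite rmorph0 ?mulr0 !mul0r ?addr0.
case=> [->|[[n ->]|[n ->]]] /=; first by rewrite mulr0 add0r.
  by case: n => [|n]; rewrite mulr0 add0r.
by rewrite addr0 mulrC.
Qed.

Lemma coadjE z w : fin_on range_word z -> coadj z w = (c w)^* * z (collapse w).
Proof.
move=> zf; rewrite /coadj /l2fun insubdK //; exact/asboolP/coadj_sqsum.
Qed.

(** Both sides of the adjunction are the same finite sum over the support of [v]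
    within [dom_word]; density of [D] places the adjoint in its closure. *)
Lemma weighted_adjointable (D W : set (l2_hilbert R word)) :
  fin_set setT `<=` D -> D `<=` fin_on dom_word -> W `<=` fin_on range_word ->
  lin_subspace W -> weakly_adjointable D W (weighted c).
Proof.
move=> finD Dfin Wfin [_ WZ].
exists coadj; split=> [k u v Wu Wv|w Ww eps eps0|v w Dv Ww].
- apply: l2_ext => w; rewrite l2_linE !coadjE //.
  + by rewrite l2_linE mulrDr mulrCA.
  + exact: Wfin.
  + exact: Wfin.
  + exact/Wfin/WZ.
- by have [y yfin ylt] := fin_dense (coadj w) eps0; exists y => //; apply: finD.
have [s [us cs ->]] := weightedE (Dfin v Dv).
rewrite -[LHS]/(l2dot _ w) -[RHS]/(l2dot v _) linear_sumlz /=.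
rewrite (@l2dot_finite _ _ v _ s) //.
  apply: eq_bigr => u _; rewrite linearZl_LR /= dot_deltal.
  rewrite coadjE; last exact: Wfin.
  by rewrite rmorphM /= conjCK mulrA [(v : l2) u * _]mulrC.
move=> u; rewrite coadjE; last exact: Wfin.
rewrite rmorphM /= conjCK mulrA [(v : l2) u * _]mulrC => nz; apply: cs => cv0.
by apply: nz; rewrite cv0 mul0r.
Qed.

End Weighted.

(** Whatever the operator does elsewhere, its adjoint maps e_00 to a vector that
    has the conjugate weights among its coordinates. *)
Lemma weighted_adjointable_sqsum c (D W : set (l2_hilbert R word))
    (k : V -> V) :
  (forall n, D (e [:: 0%N; n])) -> W (e [:: 0%N; 0%N]) ->
  (forall n, k (e [:: 0%N; n]) = c [:: 0%N; n] *: e [:: 0%N; 0%N]) ->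
  weakly_adjointable D W k -> sqsum (fun n : nat => c [:: 0%N; n]).
Proof.
move=> De We ke [k' [_ _ adj]]; pose y : l2 := k' (e [:: 0%N; 0%N]).
have yE n : y [:: 0%N; n] = (c [:: 0%N; n])^*.
  have := adj _ _ (De n) We; rewrite ke => h.
  apply: (can_inj (@conjCK _)); rewrite conjCK -dot_deltal -[LHS]h.
  rewrite -[LHS]/(l2dot _ _) linearZl_LR /= dot_deltal.
  by rewrite deltaE eqxx rmorph1 mulr1.
have [M yM] := l2P y; exists M => s us.
have uJ : uniq [seq [:: 0%N; n] | n <- s] by rewrite map_inj_uniq // => i j [].
have := yM _ uJ; rewrite big_map; apply: le_trans; apply: ler_sum => n _.
by rewrite yE norm_conjC.
Qed.

End Squeezing.

(** * The interacting Fock space with weights a and b *)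

Section WeightedFock.
Variable R : realType.
Local Notation C := R[i].
Local Notation word := (seq nat).
Local Notation l2 := (l2 R word).
Local Notation V := (l2_preHilbert R word).
Local Notation F := (wordFock R).
Local Notation e := (delta R).
Local Notation tp n := (finspan R (len n)).
Implicit Types (x z : l2) (w : word).

Definition range_comp n : set V := fin_set range_word `&` fin_set (len n).

Lemma range_comp_subspace n : lin_subspace (range_comp n).
Proof.
have [h0 hZ] := fin_set_subspace R range_word.
have [k0 kZ] := fin_set_subspace R (len n).
by split=> // k u v [u1 u2] [v1 v2]; split; [apply: hZ|apply: kZ].
Qed.

Lemma fin_len_degree n : fin_set (len n) `<=` @degree R _ F n.
Proof.
move=> z zn eps eps0; exists z; last first.
  by rewrite subrr -[ltLHS]/(l2dot 0 0) linear0l.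
by have : range (@finspan_val R word (len n)) z by rewrite range_finspan.
Qed.

Lemma range_comp_degree n : range_comp n `<=` @degree R _ F n.
Proof. by move=> z [_ /fin_len_degree]. Qed.

Lemma range_comp_vac : range_comp 0 = line (@vac R _ F).
Proof.
apply/seteqP; split=> [z [_ z0]|_ [k ->]].
  have [k zk] := word_vac_span (mk_finspan z0); exists k.
  by rewrite -[LHS]/(finspan_val (mk_finspan z0)) zk.
apply: (lin_subspaceZ _ (range_comp_subspace 0)).
by split; apply: delta_fin => //; left.
Qed.

Definition word_prefock : preFock F :=
  @PreFock R _ F range_comp
    range_comp_subspace range_comp_degree range_comp_vac.

Lemma pf_space_fin : pf_space word_prefock = fin_set range_word.
Proof. exact: graded_fin. Qed.

Lemma orth_range z : orth (pf_space word_prefock) z ->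
  forall w, range_word w -> z w = 0.
Proof.
move=> zo w rw; rewrite -dot_deltar; apply: zo; rewrite pf_space_fin.
exact: delta_fin.
Qed.

Lemma pf_D_subspace : lin_subspace (pf_D word_prefock).
Proof.
rewrite /pf_D pf_space_fin; have [h0 hZ] := fin_set_subspace R range_word.
have [o0 oZ] : lin_subspace (orth (fin_set range_word : set V)).
  split=> [a _|k u v uo vo a aR]; first exact: linear0l.
  by rewrite linearPl /= uo // vo // mulr0 addr0.
split; first by exists 0 => //; exists 0 => //; rewrite addr0.
move=> k _ _ [u hu [u' hu' ->]] [v hv [v' hv' ->]].
exists (k *: u + v); first exact: hZ.
by exists (k *: u' + v'); [exact: oZ | rewrite scalerDr addrACA].
Qed.

(** The orthogonal complement contributes nothing, since its elements have no
    coordinate on [range_word]. *)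
Lemma pf_D_fin_on : pf_D word_prefock `<=` fin_on range_word.
Proof.
move=> _ [u + [v /orth_range v0 ->]]; rewrite pf_space_fin => -[[s us] _].
by exists s => w rw; rewrite l2_addE v0 // addr0; apply: us.
Qed.

Lemma pf_D_delta w : pf_D word_prefock (e w).
Proof.
have [rw|rw] := pselect (range_word w).
  exists (e w); first by rewrite pf_space_fin; apply: delta_fin.
  by exists 0; [move=> u _; exact: linear0l | rewrite addr0].
exists 0; first by rewrite pf_space_fin; case: (fin_set_subspace R range_word).
exists (e w); last by rewrite add0r.
move=> u; rewrite pf_space_fin => -[_ ur].
rewrite -[LHS]/(l2dot _ _) dot_deltal [X in X^*](_ : _ = 0) ?rmorph0 //.
by apply: contrapT => /ur.
Qed.

(** This is why unbounded weights are harmless: removing the first letter of a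
    word in [dom_word] leaves a word in [range_word], and there the elements of
    [pf_D] are finitely supported. *)
Lemma squeeze_dom_fin_on : squeeze_dom word_prefock `<=` fin_on dom_word.
Proof.
have hT := fin_on_subspace R dom_word.
move=> _ [u [N [y [d [dD ->]]]] [v [k ->] ->]].
rewrite -[X in fin_on _ (X + _)]scale1r; apply: hT.2.
  apply: (lin_subspace_sum hT) => i _.
  have [s ds] := pf_D_fin_on (dD i).
  have [[t yt] _] := finspanP (y i : tp 1).
  exists ([::] :: [seq j :: w | j <- map (head 0%N) t, w <- s]).
  move=> [|j w] // jw.
  rewrite -[X in X <> 0]/((finspan_val (y i)) [:: j] * (d i : l2) w) => nz.
  rewrite inE; apply/orP; right; apply/allpairsP; exists (j, w); split=> //=.
    apply: (map_f (head 0%N) (yt [:: j] _)) => y0.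
    by apply: nz; rewrite y0 mul0r.
  apply: ds => [|d0]; last by apply: nz; rewrite d0 mulr0.
  by case: jw => [//|[[n [_ ->]]|[n [_ ->]]]]; [left|right; left; exists n].
apply: (lin_subspaceZ _ hT); apply: fin_fin_on; exact: (@delta_fin _ _ setT).
Qed.

(** Each basis word lies in the pre-Fock subspace or in its orthogonal
    complement, hence every nonempty word is in the tensor product of H with
    [pf_D]. *)
Lemma fin_squeeze_dom : fin_set setT `<=` squeeze_dom word_prefock.
Proof.
move=> z zf; have [s [us zs _ ->]] := fin_expand zf.
rewrite (bigID (fun w => w == [::])) /= addrC.
exists (\sum_(w <- s | w != [::]) (z : l2) w *: e w); last first.
  exists (\sum_(w <- s | w == [::]) (z : l2) w *: e w) => //.
  exists (\sum_(w <- s | w == [::]) (z : l2) w); rewrite scaler_suml.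
  by apply: eq_bigr => w /eqP ->.
rewrite -big_filter (big_nth [::]) big_mkord.
set t := filter _ s.
exists (size t),
  (fun i => (z : l2) (nth [::] t i) *:
            basis_word R 1 [:: head 0%N (nth [::] t i)]),
  (fun i => e (behead (nth [::] t i))).
split=> [i|]; first exact: pf_D_delta.
apply: eq_bigr => i _.
have : nth [::] t i \in t by rewrite mem_nth.
rewrite mem_filter => /andP[]; case: (nth _ _ _) => // j w _ _ /=.
rewrite -[RHS]/(otimes (_ *: finspan_val (basis_word R 1 [:: j])) (e w)).
rewrite basis_word_val //.
rewrite -[_ *: e [:: j]]addr0 otimes_linl otimes_delta.
have -> := otimes0l (e w).
by rewrite addr0.
Qed.

Lemma degreeE n z w : @degree R _ F n z -> size w <> n -> z w = 0.
Proof.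
move=> zn wn; apply: small_eq0 => eps eps0.
have [y [Y _ <-] lt] := zn _ (exprn_gt0 2 eps0).
rewrite -(@ltr_pXn2r _ 2) ?nnegrE ?normr_ge0 ?ltW //.
apply: le_lt_trans lt; have := l2_coord_le (z - finspan_val Y : l2) w.
rewrite l2_subE [finspan_val Y w](_ : _ = 0) ?subr0 //.
by apply: contrapT => /(finspanP Y).2.
Qed.

Variables a b : nat -> C.
Hypothesis a_neq0 : forall n, a n != 0.
Hypothesis b0_neq0 : b 0%N != 0.

(* Lambda has the weights of the squeezing in degree 1, and in degree 2 their
   product with the weights that were picked up in degree 1. *)
Local Notation kappa := (weighted (coef a b)).
Local Notation Lambda := (weighted (coef a (fun n => a n * b n))).

(** The range is the whole pre-Fock subspace because the weights at the words of
    [range_word] do not vanish. *)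
Lemma kappa_squeezing : @is_squeezing R _ F word_prefock kappa.
Proof.
have cd := @coef_dom R a b.
split.
- move=> k u v /squeeze_dom_fin_on hu /squeeze_dom_fin_on hv.
  exact: weighted_linear.
- by rewrite vacE weighted_delta /= scale1r.
- move=> n z /squeeze_dom_fin_on hz zn.
  apply/fin_len_degree/weighted_fin => // w _ zw.
  rewrite /len /mkset size_collapse; apply: contrapT => wn.
  exact/zw/(degreeE zn).
- rewrite pf_space_fin; apply/seteqP; split.
    move=> _ [z /squeeze_dom_fin_on hz <-].
    by apply: weighted_fin => // w /collapse_dom.
  have hfin := fin_set_subspace R (@setT word).
  apply: (@subset_trans _ (kappa @` (fin_set setT : set V))); last first.
    exact/image_subset/fin_squeeze_dom.
  apply: fin_set_sub => [|w rw].
    split; first by exists 0; [exact: hfin.1 | rewrite (weighted_eq0 cd)].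
    move=> k _ _ [u hu <-] [v hv <-]; exists (k *: u + v); first exact: hfin.2.
    by apply: (weighted_linear cd); apply: fin_fin_on; eassumption.
  exists ((coef a b w)^-1 *: e w).
    by apply: (lin_subspaceZ _ hfin); apply: delta_fin.
  rewrite (weightedZ cd); last first.
    by apply: fin_fin_on; apply: (@delta_fin _ _ setT).
  rewrite weighted_delta.
  have -> : collapse w = w by case: rw => [->|[[n ->]|->]].
  rewrite scalerA mulVf ?scale1r //.
  by case: rw => [->|[[n ->]|->]];
    [exact: oner_neq0 | exact: a_neq0 | exact: b0_neq0].
- move=> z [N [y [d [dD ->]]]]; rewrite (weighted_eq0 cd) // => w dw.
  rewrite l2_sumE big1 // => i _.
  rewrite -[LHS]/(otimes (finspan_val (y i : tp 1)) (d i : l2) w).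
  have dw0 := orth_range (dD i).
  case: dw => [->|[[n ->]|[n ->]]] //; rewrite otimesE dw0 ?mulr0 //.
    by left.
  by right; left; exists n.
Qed.

Lemma otimes_fin_fin (y z : V) : fin_set (len 1) y -> fin_set setT z ->
  fin_set setT (otimes y z).
Proof.
move=> [[t yt] _] [[s zs] _]; split=> //.
exists [seq j :: w | j <- map (head 0%N) t, w <- s] => -[|j w] //.
rewrite otimesE => nz; apply/allpairsP; exists (j, w); split=> //=.
  by apply: (map_f (head 0%N) (yt [:: j] _)) => y0; apply: nz; rewrite y0 mul0r.
by apply: zs => z0; apply: nz; rewrite z0 mulr0.
Qed.

(** The recursion that characterizes Lambda.  Both sides are linear in [y] and
    [z], so it is checked on basis words: a letter put before the empty word
    meets the weight a_i on either side, and one put before a letter meets the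
    product of the weights a_n and b_n. *)
Lemma Lambda_recursion (y z : V) : fin_set (len 1) y -> fin_set setT z ->
  Lambda (otimes y z) = kappa (otimes y (Lambda z)).
Proof.
have cd := @coef_dom R a b.
have ld := @coef_dom R a (fun n => a n * b n).
have finS := fin_set_subspace R (@setT word).
have oneS := fin_set_subspace R (len 1).
have lamF u : fin_set setT u -> fin_set setT (Lambda u).
  by move=> uf; apply: weighted_fin => //; apply: fin_fin_on; eassumption.
have klin c : (forall w, c w <> 0 -> dom_word w) -> forall k (u v : V),
    fin_set setT u -> fin_set setT v ->
    weighted c (k *: u + v) = k *: weighted c u + weighted c v.
  move=> h k u v hu hv.
  by apply: (weighted_linear h); apply: fin_fin_on; eassumption.
have olr (y' : V) k (u v : V) :
    otimes y' (k *: u + v) = k *: (otimes y' u : V) + otimes y' v.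
  exact: otimes_linr.
have oll k (u v z' : V) :
    otimes (k *: u + v) z' = k *: (otimes u z' : V) + otimes v z'.
  exact: otimes_linl.
move=> yf zf.
pose A : set V := [set z : V | fin_set setT z /\
  forall y : V, fin_set (len 1) y ->
    Lambda (otimes y z) = kappa (otimes y (Lambda z))].
suff /(_ z zf)[_ ->//] : fin_set setT `<=` A.
apply: fin_set_sub => [|w _].
  split=> [|k u v [uf uA] [vf vA]].
    split=> [|y' _]; first exact: finS.1.
    have lam0 : Lambda (0 : V) = 0 by apply: (weighted_eq0 ld).
    have o0 : otimes y' (0 : V) = 0 by apply: otimes0r.
    by rewrite lam0 o0 lam0 [RHS](weighted_eq0 cd).
  split=> [|y' y'f]; first exact: finS.2.
  rewrite olr (klin _ ld); [|exact: otimes_fin_fin ..].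
  rewrite uA // vA // (klin _ ld) // olr (klin _ cd) //.
    by apply: otimes_fin_fin => //; apply: lamF.
  by apply: otimes_fin_fin => //; apply: lamF.
split=> [|y' y'f]; first exact: delta_fin.
pose B : set V := [set y : V | fin_set (len 1) y /\
  Lambda (otimes y (e w)) = kappa (otimes y (Lambda (e w)))].
have fw : fin_set setT (e w : V) by apply: delta_fin.
suff /(_ y' y'f)[_ ->//] : fin_set (len 1) `<=` B.
apply: fin_set_sub => [|v v1].
  split=> [|k u v [uf uB] [vf vB]].
    split=> [|]; first exact: oneS.1.
    have o0 (z' : V) : otimes (0 : V) z' = 0 by apply: otimes0l.
    by rewrite !o0 [LHS](weighted_eq0 ld) // [RHS](weighted_eq0 cd).
  split=> [|]; first exact: oneS.2.
  rewrite oll (klin _ ld); [|exact: otimes_fin_fin ..].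
  rewrite uB vB oll (klin _ cd) //.
    by apply: otimes_fin_fin => //; apply: lamF.
  by apply: otimes_fin_fin => //; apply: lamF.
split; first exact: delta_fin.
case: v v1 => [|i []] // _.
rewrite otimes_delta !weighted_delta.
have -> (k : C) u : otimes (e [:: i]) (k *: e u) = k *: e (i :: u).
  rewrite -[k *: e u]addr0 otimes_linr otimes_delta.
  by rewrite [otimes _ 0]otimes0r addr0.
rewrite (weightedZ cd); last by apply: fin_fin_on; apply: (@delta_fin _ _ setT).
rewrite weighted_delta scalerA.
case: w fw {zf yf A B} => [|j [|k w]] _.
- by rewrite /= mul1r.
- by rewrite /=; case: i => [|i] //=; rewrite !mulr0 !scale0r.
- rewrite [coef _ _ (i :: _)]/= scale0r.
  by rewrite [coef _ _ (i :: _)](_ : _ = 0) ?mulr0 ?scale0r.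
Qed.

Lemma foldr_creator (xs : seq (one_particle R)) :
  fin_set setT (foldr (fun (x : one_particle R) (z : fbar F) => lcre F x z)
      (vac F) xs) /\
  foldr (creator (kappa : fbar F -> fbar F)) (vac F) xs =
    Lambda (foldr (fun (x : one_particle R) (z : fbar F) => lcre F x z)
      (vac F) xs).
Proof.
elim: xs => [|x xs [IH1 IH2]] /=.
  by rewrite vacE weighted_delta scale1r; split=> //; apply: delta_fin.
have xf := finspanP (x : tp 1); split; first exact: otimes_fin_fin.
rewrite /creator IH2; exact/esym/Lambda_recursion.
Qed.

Definition weightedIFS : interactingFock R := InteractingFock kappa_squeezing.

Lemma squeezing_adjointable_iff :
  squeezing_weakly_adjointable (if_prefock weightedIFS)
    (if_squeeze weightedIFS) <-> sqsum b.
Proof.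
split=> [|hb].
  apply: (@weighted_adjointable_sqsum _ (coef a b)) => [n||n].
  - exact/fin_squeeze_dom/delta_fin.
  - exact: pf_D_delta.
  - exact: weighted_delta.
apply: weighted_adjointable => //.
- exact: coef_dom.
- exact: fin_squeeze_dom.
- exact: squeeze_dom_fin_on.
- exact: pf_D_fin_on.
- exact: pf_D_subspace.
Qed.

Lemma regular_iff :
  regular (if_prefock weightedIFS) (if_squeeze weightedIFS) <->
  sqsum (fun n => a n * b n).
Proof.
split=> [[L [Llin Lvac LL]]|hb].
  apply: (@weighted_adjointable_sqsum _ (coef a (fun n => a n * b n)))
    => [n||n].
  - by rewrite algFock_fin; apply: delta_fin.
  - by rewrite pf_space_fin; apply: delta_fin; right; right.
  - pose xs : seq (one_particle R) :=
      [:: basis_word R 1 [:: 0%N]; basis_word R 1 [:: n]].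
    have := LL xs; rewrite (foldr_creator xs).2 /=.
    rewrite vacE -[lcre F _ (e _)]
      /(otimes (finspan_val (basis_word R 1 [:: n])) (e [::])).
    rewrite basis_word_val // otimes_delta.
    rewrite -[lcre F _ (e _)]
      /(otimes (finspan_val (basis_word R 1 [:: 0%N])) (e [:: n])).
    by rewrite basis_word_val // otimes_delta weighted_delta.
exists Lambda.
  split.
  - move=> k u v; rewrite algFock_fin => uf vf.
    apply: weighted_linear; first exact: coef_dom.
      by apply: fin_fin_on; eassumption.
    by apply: fin_fin_on; eassumption.
  - by rewrite vacE weighted_delta scale1r.
  - by move=> xs; rewrite (foldr_creator xs).2.
apply: weighted_adjointable => //.
- exact: coef_dom.
- by rewrite algFock_fin.
- by rewrite algFock_fin => z zf; apply: fin_fin_on; eassumption.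
- by rewrite pf_space_fin => z zf; apply: fin_fin_on; eassumption.
- by rewrite pf_space_fin; apply: fin_set_subspace.
Qed.

End WeightedFock.

(** * The two choices of weights *)

Section Weights.
Variable R : realType.
Local Notation C := R[i].

Definition half_pow (n : nat) : C := 2^-1 ^+ n.

Lemma half_pow_neq0 n : half_pow n != 0.
Proof. by rewrite expf_neq0 // invr_neq0 // pnatr_eq0. Qed.

Lemma sqsum_half_pow : sqsum half_pow.
Proof.
exists (4 / 3) => s us.
have geom N :
    \sum_(n <- iota 0 N) `|half_pow n| ^+ 2 = (4 / 3) * (1 - 4^-1 ^+ N).
  elim: N => [|N IH]; first by rewrite big_nil expr0 subrr mulr0.
  rewrite -addn1 iotaD big_cat big_seq1 IH add0n addn1.
  rewrite normrX normfV normr_nat -exprM mulnC exprM.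
  have -> : (2^-1 : C) ^+ 2 = 4^-1 by rewrite exprVn -natrX.
  by rewrite exprS /=; move: (_ ^+ N) => t; field.
pose N := (\max_(n <- s) n).+1.
have sub : {subset s <= iota 0 N}.
  move=> n ns; rewrite mem_iota add0n /= ltnS.
  exact: (@leq_bigmax_seq _ s xpredT id n).
apply: (@le_trans _ _ (\sum_(n <- iota 0 N) `|half_pow n| ^+ 2)).
  rewrite (sum_extend _ us (iota_uniq 0 N) sub) lerDl sumr_ge0 // => n _.
  by rewrite exprn_ge0.
rewrite geom -[leRHS]mulr1 ler_wpM2l ?divr_ge0 ?ler0n //.
by rewrite lerBlDr lerDl exprn_ge0 // invr_ge0 ler0n.
Qed.

Lemma not_sqsum1 : ~ sqsum (fun n : nat => 1 : C).
Proof.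
move=> [M hM].
have bd N : N%:R <= M.
  have := hM _ (iota_uniq 0 N); rewrite normr1 expr1n.
  by rewrite big_const_seq count_predT size_iota iter_addr_0.
have M0 : 0 <= M := bd 0%N.
have ReM : (complex.Re M)%:C%C = M by rewrite RRe_real ?ger0_real.
have Re0 : 0 <= complex.Re M by rewrite -ler0c ReM.
have := archi_boundP Re0; rewrite ltNge; move/negP; apply.
by rewrite -lecR ReM rmorph_nat.
Qed.

End Weights.

Theorem corollary8p2 (R : realType) :
  (exists K : interactingFock R,
     squeezing_weakly_adjointable (if_prefock K) (if_squeeze K) /\
     ~ regular (if_prefock K) (if_squeeze K)) /\
  (exists K : interactingFock R,
     regular (if_prefock K) (if_squeeze K) /\
     ~ squeezing_weakly_adjointable (if_prefock K) (if_squeeze K)).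
Proof.
have inv_neq0 n : (half_pow R n)^-1 != 0 by rewrite invr_neq0 ?half_pow_neq0.
split.
  exists (weightedIFS inv_neq0 (half_pow_neq0 R 0)).
  rewrite regular_iff squeezing_adjointable_iff.
  split; first exact: sqsum_half_pow.
  under [X in sqsum X]funext => n do rewrite mulVf ?half_pow_neq0 //.
  exact: not_sqsum1.
exists (@weightedIFS R (half_pow R) (fun=> 1) (half_pow_neq0 R) (oner_neq0 _)).
rewrite regular_iff squeezing_adjointable_iff; split; last exact: not_sqsum1.
by under [X in sqsum X]funext => n do rewrite mulr1; exact: sqsum_half_pow.
Qed.
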